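(* Let $G=(V,E)$ be a finite, connected, directed graph and let $(\eta_n,q_n)_{n}$ be a stochastic network in a Markovian environment on $G$, with environment sets $S_v$, transition matrices $P_v$, toppling laws $\nu^{v,s}$ with samples $\xi^{v,s}$, threshold $\mathsf t:V\to\mathbb N_0$ and expected toppling matrix $M$. Assume: (a) for all $v\in V$, $s\in S_v$ and $w\in V\setminus\{v\}$, $\xi^{v,s}(w)\ge 0$ almost surely; (b) for all $v\in V$ and $s\in S_v$, $-\xi^{v,s}(v)\le \mathsf t(v)$ almost surely; (c) there exists an integer $k\geq 1$ such that $(M-\mathrm{Diag}(M))^k(v,w)>0$ for all distinct $v,w\in V$. Let $\alpha=\max\{-M(v,v): v\in V\}+1$ and $\rho=r(M+\alpha I)-\alpha$, where $r(M+\alpha I)$ is the Perron--Frobenius eigenvalue of $M+\alpha I$. Then: 1. (Subcritical case) If $\rho<0$, then for every initial configuration $\eta_0:V\to\mathbb N_0$ and every initial environment $q_0\in S$, the network stabilizes almost surely. 2. (Critical case) If $\rho=0$, then exactly one of the following holds: either there exists a conserved quantity for the network, or the network stabilizes almost surely for every initial state $(\eta_0,q_0)\in\mathbb N_0^V\times S$. 3. (Supercritical case) If $\rho>0$, then for every initial environment $q_0\in S$ there exists an initial configuration $\eta_0:V\to\mathbb N_0$ for which the network does not stabilize with positive probability.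
   Context: For each $v\in V$: $S_v$ is a finite nonempty set (environment states at $v$), $P_v\in\mathbb R^{S_v\times S_v}$ is an irreducible and aperiodic stochastic matrix, and $\pi_v$ is its stationary distribution. $S=\prod_{v\in V}S_v$ is the set of global environments. For $v\in V$, $s\in S_v$, $\nu^{v,s}$ is a probability distribution on $\mathbb Z^V$ (functions $V\to\mathbb Z$) with finite expectation $\mu^{v,s}\in\mathbb R^V$; $\xi^{v,s}$ denotes a sample from $\nu^{v,s}$. The expected toppling matrix is $M(v,w)=\sum_{s\in S_v}\pi_v(s)\mu^{v,s}(w)$, $v,w\in V$. $\mathrm{Diag}(M)$ is the matrix that agrees with $M$ on the diagonal and is zero off the diagonal. Under the assumptions $M+\alpha I$ is a nonnegative primitive matrix, and $r(M+\alpha I)$ is its spectral radius. Stochastic network in Markovian environment: given an initial configuration $\eta_0:V\to\mathbb N_0$, an initial global environment $q_0\in S$ and a threshold $\mathsf t:V\to\mathbb N_0$, it is the Markov chain $(\eta_n,q_n)_{n\ge0}$ on configurations and environments evolving as follows. If $\eta_n(v)\le\mathsf t(v)$ for all $v\in V$, then $\eta_n$ is called stable and the process terminates (stays constant). Otherwise, given $(\eta_n,q_n)$, a vertex $\mathsf v_n$ is chosen at random with $\mathbb P(\mathsf v_n=v)=\max\{\eta_n(v)-\mathsf t(v),0\}\big/\sum_{u\in V}\max\{\eta_n(u)-\mathsf t(u),0\}$; then $q_{n+1}(w)=q_n(w)$ for $w\ne\mathsf v_n$, and $q_{n+1}(\mathsf v_n)=s$ with probability $P_{\mathsf v_n}(q_n(\mathsf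 v_n),s)$ for $s\in S_{\mathsf v_n}$; finally, with $s=q_{n+1}(\mathsf v_n)$, a vector $\xi_{n+1}$ is sampled from $\nu^{\mathsf v_n,s}$ (independently of the past given $\mathsf v_n$ and $s$) and $\eta_{n+1}=\eta_n+\xi_{n+1}$. The network stabilizes if there exists $n$ such that $\eta_n$ is stable. Conserved quantity: a nonzero vector $a\in\mathbb R^V$ together with functions $\varphi(v,\cdot):S_v\to\mathbb R$, $v\in V$, such that for every initial state $(\eta_0,q_0)\in\mathbb N_0^V\times S$, almost surely the quantity $\sum_{v\in V}\big(a(v)\eta_n(v)+\varphi(v,q_n(v))\big)$ is constant in $n$. *)

(* Defs.v *)
From HB Require Import structures.
From mathcomp Require Import all_boot all_order all_algebra.
From mathcomp Require Import complex.
From mathcomp Require Import all_classical all_reals all_analysis.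

Set Implicit Arguments.
Unset Strict Implicit.
Unset Printing Implicit Defensive.

Import Order.TTheory GRing.Theory Num.Theory.

Local Open Scope classical_set_scope.
Local Open Scope ring_scope.

Definition fin_mx (R : Type) (T : finType) (f : T -> T -> R) : 'M[R]_#|T| :=
  \matrix_(i, j) f (enum_val i) (enum_val j).

Definition entry (R : Type) (T : finType) (A : 'M[R]_#|T|) (x y : T) : R :=
  A (enum_rank x) (enum_rank y).

Definition diag_part (R : realType) (n : nat) (A : 'M[R]_n) : 'M[R]_n :=
  diag_mx (\row_i A i i).

(* The eigenvalues range over the complex numbers [complex R]. *)
Definition spectral_radius (R : realType) (n : nat) (A : 'M[R]_n) : R :=
  sup [set ComplexField.Normc.normc l | l in
         [set l : complex R | eigenvalue (map_mx (real_complex R) A) l]].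

Definition stochastic (R : realType) (T : finType) (P : T -> T -> R) : Prop :=
  (forall x y, 0 <= P x y) /\ (forall x, \sum_y P x y = 1).

Definition irreducible (R : realType) (T : finType) (P : T -> T -> R) : Prop :=
  forall x y, exists n, 0 < entry (fin_mx P ^+ n) x y.

(* The gcd of the return times of every state is 1. *)
Definition aperiodic (R : realType) (T : finType) (P : T -> T -> R) : Prop :=
  forall (x : T) (d : nat),
    (forall n, (0 < n)%N -> 0 < entry (fin_mx P ^+ n) x x -> (d %| n)%N) ->
    d = 1%N.

Definition stationary (R : realType) (T : finType) (P : T -> T -> R)
    (pi : T -> R) : Prop :=
  [/\ forall x, 0 <= pi x, \sum_x pi x = 1
    & forall y, \sum_x pi x * P x y = pi y].

(* Connectedness of a directed graph: its underlying undirected graph is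
   nonempty and connected. *)
Definition connected_digraph (V : finType) (E : rel V) : Prop :=
  (0 < #|V|)%N /\
  forall v w : V, connect (fun x y => E x y || E y x) v w.

Definition config (V : finType) : Type := {ffun V -> int}.

HB.instance Definition _ (V : finType) := Countable.on (config V).
HB.instance Definition _ (V : finType) := GRing.Zmodule.on (config V).
HB.instance Definition _ (V : finType) := isPointed.Build (config V) 0.

(* The countable set Z^V carries the discrete sigma-algebra. *)
HB.instance Definition _ (V : finType) :=
  @isMeasurable.Build default_measure_display (config V)
    discrete_measurable discrete_measurable0
    discrete_measurableC discrete_measurableU.

Definition config_of_nat (V : finType) (eta : V -> nat) : config V :=
  [ffun v => (eta v)%:Z].

Definition environment (V : finType) (S : V -> finType) : Type :=
  {dffun forall v, S v}.

HB.instance Definition _ (V : finType) (S : V -> finType) :=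
  Finite.on (environment S).

Definition update_env (V : finType) (S : V -> finType) (q : environment S)
    (v : V) (s : S v) : environment S :=
  finfun (@eqtype.dfwith V S q v s).

Record network (R : realType) (V : finType) : Type := Network {
  env_state : V -> finType;
  env_trans : forall v, env_state v -> env_state v -> R;
  env_stat : forall v, env_state v -> R;
  topple_law : forall v, env_state v -> probability (config V) R;
  threshold : V -> nat;
  env_state_gt0 : forall v, (0 < #|env_state v|)%N;
  env_trans_stochastic : forall v, stochastic (@env_trans v);
  env_trans_irreducible : forall v, irreducible (@env_trans v);
  env_trans_aperiodic : forall v, aperiodic (@env_trans v);
  env_stat_stationary : forall v, stationary (@env_trans v) (@env_stat v);
  topple_law_integrable : forall v (s : env_state v) (w : V),
    (topple_law s).-integrable setT (fun z : config V => ((z w)%:~R : R)%:E) }.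

Arguments env_trans {R V} n v.
Arguments env_stat {R V} n v.
Arguments topple_law {R V} n v s.

Notation env N := (environment (env_state N)).

Definition mean_topple (R : realType) (V : finType) (N : network R V)
    (v : V) (s : env_state N v) (w : V) : R :=
  fine ('E_(topple_law N v s)[fun z : config V => (z w)%:~R])%E.

Definition topple_mx (R : realType) (V : finType) (N : network R V) :
    'M[R]_#|V| :=
  fin_mx (fun v w => \sum_s env_stat N v s * mean_topple s w).

Definition stable (R : realType) (V : finType) (N : network R V)
    (eta : config V) : bool :=
  [forall v, eta v <= (threshold N v)%:Z].

Definition excess (R : realType) (V : finType) (N : network R V)
    (eta : config V) (v : V) : R :=
  (Num.max (eta v - (threshold N v)%:Z) 0)%:~R.

Definition choice_prob (R : realType) (V : finType) (N : network R V)
    (eta : config V) (v : V) : R :=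
  excess N eta v / \sum_u excess N eta u.

(* Transition probability from (eta, q) to (eta', q').  Off the stable
   configurations: sum over the chosen vertex v and the new state s at v, the
   displacement xi being the one with eta' = eta + xi. *)
Definition trans_prob (R : realType) (V : finType) (N : network R V)
    (eta : config V) (q : env N) (eta' : config V) (q' : env N) : \bar R :=
  if stable N eta then (((eta' == eta) && (q' == q))%:R)%:E
  else (\sum_(v : V) \sum_(s : env_state N v)
          (choice_prob N eta v * env_trans N v (q v) s
             * (q' == update_env q s)%:R)%:E
          * topple_law N v s [set xi | eta' = (eta + xi)%R])%E.

(* The network started from (eta0, q0): a process on some probability space
   which is a Markov chain with the above transition probabilities.
   Configurations take values in Z^V; under the hypotheses of the theorem they
   almost surely stay nonnegative. *)
Record realization (R : realType) (V : finType) (N : network R V)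
    (eta0 : V -> nat) (q0 : env N) : Type := Realization {
  disp : measure_display;
  sample : measurableType disp;
  law : probability sample R;
  eta_ : nat -> sample -> config V;
  q_ : nat -> sample -> env N;
  eta_measurable : forall n x, measurable [set w | eta_ n w = x];
  q_measurable : forall n e, measurable [set w | q_ n w = e];
  init : {ae law, forall w,
            eta_ 0%N w = config_of_nat eta0 /\ q_ 0%N w = q0};
  markov : forall (n : nat) (x : nat -> config V) (e : nat -> env N),
    law [set w | forall i, (i <= n.+1)%N -> eta_ i w = x i /\ q_ i w = e i]
    = (law [set w | forall i, (i <= n)%N -> eta_ i w = x i /\ q_ i w = e i]
       * trans_prob (x n) (e n) (x n.+1) (e n.+1))%E }.

Arguments law {R V N eta0 q0} r.
Arguments eta_ {R V N eta0 q0} r n w.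
Arguments q_ {R V N eta0 q0} r n w.

Definition stabilization_event (R : realType) (V : finType) (N : network R V)
    (eta0 : V -> nat) (q0 : env N) (X : realization eta0 q0) :
    set (sample X) :=
  [set w | exists n, stable N (eta_ X n w)].

Arguments stabilization_event {R V N eta0 q0} X _.

Definition stabilizes_as (R : realType) (V : finType) (N : network R V)
    (eta0 : V -> nat) (q0 : env N) (X : realization eta0 q0) : Prop :=
  {ae law X, forall w, stabilization_event X w}.

Definition charge_at (R : realType) (V : finType) (S : V -> finType)
    (a : V -> R) (phi : forall v, S v -> R)
    (eta : config V) (q : environment S) : R :=
  \sum_v (a v * (eta v)%:~R + phi v (q v)).

Definition conserved_quantity (R : realType) (V : finType) (N : network R V)
    (X : forall (eta0 : V -> nat) (q0 : env N), realization eta0 q0)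
    (a : V -> R) (phi : forall v, env_state N v -> R) : Prop :=
  (exists v, a v != 0) /\
  forall (eta0 : V -> nat) (q0 : env N),
    {ae law (X eta0 q0), forall w, forall n,
       charge_at a phi (eta_ (X eta0 q0) n w) (q_ (X eta0 q0) n w)
       = charge_at a phi (eta_ (X eta0 q0) 0 w) (q_ (X eta0 q0) 0 w)}.

(* V is finite and nonempty, so the supremum is a maximum. *)
Definition alpha_of (R : realType) (V : finType) (M : 'M[R]_#|V|) : R :=
  sup [set - entry M v v | v in [set: V]] + 1.

Definition rho_of (R : realType) (V : finType) (M : 'M[R]_#|V|) : R :=
  spectral_radius (M + (alpha_of M)%:M) - alpha_of M.

(* Main.v *)
Require Import Defs.
From HB Require Import structures.
From mathcomp Require Import all_boot all_order all_algebra.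
From mathcomp Require Import all_classical all_reals all_analysis.
From mathcomp Require Import measurable_realfun.
From mathcomp Require Import complex ring lra.

(** Why the three regimes hold.

    Let [M] be the expected toppling matrix.  Perron-Frobenius theory for
    [M + alpha I] gives positive weights [a] with [M a = rho a].  A particle at
    [v] is counted with weight [a v]; this count drifts by [rho * a v] when [v]
    topples only on average over the stationary law of its environment.  The
    Poisson equation of each environment yields a correction [phi] that removes
    the average: the charge, the sum over [v] of [a v * eta v + phi v (q v)],
    has conditional drift [rho * a v] from every state ([exists_corrector],
    [transfer_potential]).  Configurations remain nonnegative
    ([nonneg_closed]), hence the charge is bounded below and has finite
    sublevel sets.

    If [rho <= 0], the charge is a Lyapunov function.  It exceeds a level [K]
    with probability of order [1 / K], and below [K] there are finitely many
    states, in which the network cannot stay forever unstable unless they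
    contain a trap, a finite set of unstable states closed under the dynamics
    ([Lyapunov_absorbed]).  On a trap the minimum principle forces [rho = 0]
    and a smaller trap on which the charge is constant
    ([trap_constant_charge]); so there is no trap if [rho < 0].  If [rho = 0]
    and there is a trap, a minimal one is considered: because [M] and the
    environments are irreducible, every vertex topples in it from every
    environment state ([all_topplable]).  All topplings that the network can
    perform therefore preserve the charge, which is a conserved quantity.

    Conversely, averaging over the environments shows that the weights [b] of a
    conserved quantity satisfy [M b = 0].  By simplicity of the Perron
    eigenvalue they are multiples of [a], and a configuration of large charge
    can never become stable ([critical_exclusive]).

    If [rho > 0], the charge drifts upwards by steps that are bounded below and
    have a first moment.  This suffices for the inverse of the charge to be
    superharmonic far from the stable states ([inverse_expectation],
    [exists_escape_function]); from a large initial charge the network is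
    stable at any given time with probability at most [1 / 2], and stable
    states are absorbing.

    All probabilities are estimated through the transition operator
    [transfer] on the countable set of states: a family of functions that
    decreases along the dynamics bounds expectations at time [n]
    ([expect_le]). *)

Set Implicit Arguments.
Unset Strict Implicit.
Unset Printing Implicit Defensive.

Import Order.TTheory GRing.Theory Num.Theory.
Import numFieldNormedType.Exports.

Local Open Scope classical_set_scope.
Local Open Scope ring_scope.

(** * Perron-Frobenius theory of a primitive matrix *)

Section PerronFrobenius.
Import ComplexField.
Variable R : realType.

Lemma mulmx_ge0 m n p (A : 'M[R]_(m, n)) (B : 'M[R]_(n, p)) :
  (forall i j, 0 <= A i j) -> (forall i j, 0 <= B i j) ->
  forall i j, 0 <= (A *m B) i j.
Proof. by move=> A0 B0 i j; rewrite mxE sumr_ge0// => l _; rewrite mulr_ge0. Qed.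

Lemma row_neq0P (K : nmodType) n (x : 'rV[K]_n) : x != 0 -> exists i, x 0 i != 0.
Proof.
move=> xn0; apply/existsP; apply: contraNT xn0 => /existsPn xz.
by apply/eqP/rowP => i; rewrite mxE; apply/eqP; rewrite -[_ == _]negbK xz.
Qed.

Lemma mulmx_gt0 n (x : 'rV[R]_n) (B : 'M[R]_n) :
  (forall j, 0 <= x 0 j) -> x != 0 -> (forall i j, 0 < B i j) ->
  forall j, 0 < (x *m B) 0 j.
Proof.
move=> x0 /row_neq0P[i xi] B0 j; rewrite mxE (bigD1 i)//=.
apply: ltr_pwDl; first by rewrite mulr_gt0// lt0r xi x0.
by rewrite sumr_ge0// => l _; rewrite mulr_ge0// ltW.
Qed.

Lemma exists_ratio_lb (I : finType) (z w : I -> R) :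
  (forall j, 0 < z j) -> (forall j, 0 < w j) ->
  exists2 e, 0 < e & forall j, e * z j <= w j.
Proof.
move=> z0 w0; pose S := 1 + \sum_j z j / w j.
have zw0 j : 0 < z j / w j by rewrite divr_gt0.
have S0 : 0 < S by rewrite ltr_pwDl// sumr_ge0// => j _; rewrite ltW.
(* [S] exceeds every ratio [z j / w j], so its inverse is a lower bound. *)
exists S^-1; first by rewrite invr_gt0.
move=> j; rewrite mulrC ler_pdivrMr// -ler_pdivrMl// mulrC.
rewrite /S (bigD1 j)//= addrCA lerDl addr_ge0// sumr_ge0// => i _.
exact: ltW.
Qed.

Lemma mulmx_exp_eigen n (A : 'M[R]_n) (x : 'rV[R]_n) r k :
  x *m A = r *: x -> x *m (A ^+ k) = r ^+ k *: x.
Proof.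
move=> xA; elim: k => [|k IH]; first by rewrite !expr0 mulmx1 scale1r.
by rewrite exprS mulmxA xA -scalemxAl IH scalerA -exprS.
Qed.

Lemma trmx_exp n (A : 'M[R]_n) k : A^T ^+ k = (A ^+ k)^T.
Proof.
elim: k => [|k IH]; first by rewrite !expr0 trmx1.
by rewrite exprS IH exprSr trmx_mul.
Qed.

(** The pairs that compete in the Collatz-Wielandt maximum. *)
Definition subinvariant n (A : 'M[R]_n) : set ('rV[R]_n * R) :=
  [set p : 'rV[R]_n * R | [/\ forall j, 0 <= p.1 0 j, \sum_j p.1 0 j = 1, 0 <= p.2
             & forall j, p.2 * p.1 0 j <= (p.1 *m A) 0 j]].

Lemma continuous_coord n (j : 'I_n) :
  continuous (fun p : 'rV[R]_n * R => p.1 0 j).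
Proof.
move=> p; apply: (@continuous_comp _ _ _ (@fst _ _) (fun x : 'rV[R]_n => x 0 j)).
  exact: cvg_fst.
exact: coord_continuous.
Qed.

Lemma continuous_sum (T : topologicalType) (I : finType) (F : I -> T -> R) :
  (forall i, continuous (F i)) -> continuous (fun x => \sum_i F i x).
Proof.
by move=> cF; apply: continuous_big => // -[x y]; exact: add_continuous.
Qed.

Lemma continuous_mulmx n (A : 'M[R]_n) (j : 'I_n) :
  continuous (fun p : 'rV[R]_n * R => (p.1 *m A) 0 j).
Proof.
rewrite (_ : (fun p => _) = (fun p : 'rV[R]_n * R => \sum_i p.1 0 i * A i j));
  last by apply/funext => p; rewrite mxE.
apply: continuous_sum => i p; apply: cvgM; last exact: cvg_cst.
exact: continuous_coord.
Qed.

Lemma subinvariant_bound n (A : 'M[R]_n) p : (forall i j, 0 <= A i j) ->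
  subinvariant A p -> p.2 <= \sum_j \sum_i A i j.
Proof.
move=> A0 [p0 p1 l0 pA].
rewrite -[leLHS]mulr1 -p1 mulr_sumr; apply: ler_sum => j _.
apply: le_trans (pA j) _; rewrite mxE; apply: ler_sum => i _.
rewrite ler_piMl// -p1 (bigD1 i)//= lerDl sumr_ge0//.
Qed.

Lemma closed_subinvariant n (A : 'M[R]_n) : closed (subinvariant A).
Proof.
have cl1 (f : 'rV[R]_n * R -> R) : continuous f -> closed [set p | 0 <= f p].
  move=> cf; rewrite (_ : [set p | _] = f @^-1` [set x | 0 <= x])//.
  by apply: preimage_closed; [move=> x _; exact: cf|exact: closed_ge].
have cl2 (f : 'rV[R]_n * R -> R) : continuous f -> closed [set p | f p = 1].
  move=> cf; rewrite (_ : [set p | _] = f @^-1` [set x | x = 1])//.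
  by apply: preimage_closed; [move=> x _; exact: cf|exact: closed_eq].
rewrite (_ : subinvariant A =
   (\bigcap_(j in [set: 'I_n]) [set p : 'rV[R]_n * R | 0 <= p.1 0 j]) `&`
   [set p : 'rV[R]_n * R | \sum_j p.1 0 j = 1] `&`
   [set p : 'rV[R]_n * R | 0 <= p.2] `&`
   (\bigcap_(j in [set: 'I_n])
     [set p : 'rV[R]_n * R | 0 <= (p.1 *m A) 0 j - p.2 * p.1 0 j])).
  repeat apply: closedI.
  - by apply: closed_bigI => j _; apply: cl1; exact: continuous_coord.
  - by apply: cl2; apply: continuous_sum => j; exact: continuous_coord.
  - by apply: cl1 => p; exact: cvg_snd.
  - apply: closed_bigI => j _; apply: cl1 => p; apply: cvgB.
      exact: continuous_mulmx.
    by apply: cvgM; [exact: cvg_snd|exact: continuous_coord].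
apply/seteqP; split => p.
  move=> [h1 h2 h3 h4]; split; last by move=> j _; rewrite /= subr_ge0.
  by split => //; split => // j _; exact: h1.
move=> [[[h1 h2] h3] h4]; split => [j|//|//|j]; first exact: h1.
by rewrite -subr_ge0; exact: h4.
Qed.

Lemma compact_subinvariant n (A : 'M[R]_n) : (forall i j, 0 <= A i j) ->
  compact (subinvariant A).
Proof.
move=> A0.
have cK : compact ([set x : 'rV[R]_n | forall j, x ord0 j \in `[0, 1]] `*`
    `[0, \sum_j \sum_i A i j]%classic).
  apply: compact_setX; last exact: segment_compact.
  apply: (@rV_compact R _ (fun=> `[0, 1]%classic)) => j.
  exact: segment_compact.
apply: subclosed_compact (@closed_subinvariant _ _) cK _ => p pK.
have := subinvariant_bound A0 pK; case: pK => p0 p1 l0 _ lb; split => /=.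
  move=> j; have -> : ord0 = 0 :> 'I_1 by exact: val_inj.
  rewrite in_itv/= p0 -p1 (bigD1 j)//= lerDl sumr_ge0//.
by rewrite in_itv/= l0.
Qed.

(** Collatz-Wielandt: the largest [r] admitting a nonnegative normalised [x]
    with [r x <= x A] exists by compactness.  If the inequality were not an
    equality, multiplying by the positive matrix [A ^+ k] would make it strict
    everywhere, and [r] could be increased. *)
Lemma exists_Perron_row n (A : 'M[R]_n) k : (0 < n)%N ->
  (forall i j, 0 <= A i j) -> (forall i j, 0 < (A ^+ k) i j) ->
  exists r (x : 'rV[R]_n), [/\ 0 <= r, forall j, 0 < x 0 j & x *m A = r *: x].
Proof.
move=> n0 A0 Ak0.
have nR : n%:R != 0 :> R by rewrite pnatr_eq0 -lt0n.
have [[x r] xrK rmax] : exists2 p, subinvariant A p &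
    forall q, subinvariant A q -> q.2 <= p.2.
  have [||c cK cmax] :=
      @compact_EVT_max _ _ (@snd 'rV[R]_n R) _ _ (compact_subinvariant A0).
  - exists (const_mx n%:R^-1, 0); split => //=.
    + by move=> j; rewrite mxE invr_ge0.
    + under eq_bigr do rewrite mxE.
      by rewrite sumr_const card_ord -[LHS]mulr_natr mulVf.
    + move=> j; rewrite mul0r mxE sumr_ge0// => i _.
      by rewrite mxE mulr_ge0// invr_ge0.
  - by apply: continuous_subspaceT => p; exact: cvg_snd.
  - by exists c; [rewrite inE in cK|move=> q qK; apply: cmax; rewrite inE].
case: xrK => /= x0 x1 r0 xA.
exists r, x.
have xn0 : x != 0.
  apply/eqP => xE; move: x1; rewrite xE; under eq_bigr do rewrite mxE.
  by rewrite big1// => /eqP; rewrite eq_sym oner_eq0.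
have z0 := mulmx_gt0 x0 xn0 Ak0.
have xAE : x *m A = r *: x.
  apply/eqP; rewrite -subr_eq0; apply/negPn/negP => yn0.
  have y0 j : 0 <= (x *m A - r *: x) 0 j by move: (xA j); rewrite !mxE subr_ge0.
  have w0 := mulmx_gt0 y0 yn0 Ak0.
  set z := x *m A ^+ k in z0.
  have wE : (x *m A - r *: x) *m A ^+ k = z *m A - r *: z.
    rewrite mulmxBl -scalemxAl -!mulmxA; congr (_ *m _ - _).
    by rewrite -[LHS]/(A * A ^+ k) -exprS exprSr.
  have [e e0 ez] := exists_ratio_lb z0 w0.
  pose s := \sum_j z 0 j.
  have s0 : 0 < s.
    rewrite /s (bigD1 (Ordinal n0))//=.
    by apply: ltr_pwDl => //; rewrite sumr_ge0// => j _; exact: ltW.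
  have : subinvariant A (s^-1 *: z, r + e).
    split => /=.
    - by move=> j; rewrite mxE mulr_ge0// ?invr_ge0 ltW.
    - under eq_bigr do rewrite mxE.
      by rewrite -mulr_sumr mulVf// gt_eqF.
    - by rewrite addr_ge0// ltW.
    - move=> j; rewrite -scalemxAl [in leLHS]mxE [in leRHS]mxE mulrCA.
      rewrite ler_pM2l ?invr_gt0// mulrDl.
      have : e * z 0 j <= (z *m A) 0 j - r * z 0 j.
        by move: (ez j); rewrite wE !mxE.
      by lra.
  by move=> /rmax /=; rewrite gerDl leNgt e0.
split => // j.
rewrite lt0r x0 andbT; apply/eqP => xj0.
by have := z0 j; rewrite (mulmx_exp_eigen _ xAE) mxE xj0 mulr0 ltxx.
Qed.

(** Pairing the entrywise modulus of a complex eigenvector with the positive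
    eigenvector bounds every eigenvalue by [r]; transposing, the two positive
    eigenvectors have the same eigenvalue, so that [r] is attained. *)
Lemma spectral_radius_Perron n (A : 'M[R]_n) k : (0 < n)%N ->
  (forall i j, 0 <= A i j) -> (forall i j, 0 < (A ^+ k) i j) ->
  exists x : 'cV[R]_n, (forall j, 0 < x j 0) /\
    A *m x = spectral_radius A *: x.
Proof.
move=> n0 A0 Ak0.
have [r [u [r0 u0 uA]]] := exists_Perron_row n0 A0 Ak0.
have [s [y [s0 y0 yA]]] : exists r (x : 'rV[R]_n),
    [/\ 0 <= r, forall j, 0 < x 0 j & x *m A^T = r *: x].
  apply: (@exists_Perron_row n A^T k n0) => i j; first by rewrite mxE.
  by rewrite trmx_exp mxE.
pose x := y^T.
have x0 j : 0 < x j 0 by rewrite mxE.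
have Ax : A *m x = s *: x by rewrite -[A]trmxK -trmx_mul yA linearZ.
clearbody x => {y0 yA y}.
have pos (w : 'I_n -> R) i : (forall j, 0 <= w j) -> w i != 0 ->
    0 < \sum_j w j * x j 0.
  move=> w0 wi; rewrite (bigD1 i)//=.
  apply: ltr_pwDl; first by rewrite mulr_gt0// lt0r wi w0.
  by rewrite sumr_ge0// => l _; rewrite mulr_ge0// ltW.
have rs : r = s.
  have /matrixP/(_ 0 0) : r *: (u *m x) = s *: (u *m x).
    by rewrite scalemxAl -uA -mulmxA Ax -scalemxAr.
  rewrite !mxE; apply: mulIf; rewrite gt_eqF//.
  by apply: (pos _ (Ordinal n0)) => [j|]; rewrite ?gt_eqF ?ltW.
exists x; split => //; rewrite Ax; congr (_ *: _).
rewrite /spectral_radius; set D := [set _ | _ in _].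
have Dub : ubound D s.
  move=> _ [l /= /eigenvalueP[v vA /row_neq0P[i vi]] <-].
  pose w j := Normc.normc (v 0 j).
  have w0 j : 0 <= w j by rewrite /w; case: (v 0 j) => a b; exact: sqrtr_ge0.
  have wi : w i != 0.
    by apply: contraNneq vi => /Normc.eq0_normc/eqP.
  rewrite -(ler_pM2r (pos w i w0 wi)) mulr_sumr.
  have lw j : Normc.normc l * w j <= \sum_i w i * A i j.
    rewrite -Normc.normcM.
    have /rowP/(_ j) := vA; rewrite !mxE => <-.
    elim/big_rec2: _ => [|m a b _ ab]; first by rewrite Normc.normc0.
    apply: le_trans (@le_normcD R _ _) _; apply: lerD => //.
    rewrite Normc.normcM mxE ler_wpM2l//; first exact: w0.
    by rewrite /= expr0n/= addr0 sqrtr_sqr ger0_norm.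
  apply: (@le_trans _ _ (\sum_j (\sum_i w i * A i j) * x j 0)).
    by apply: ler_sum => j _; rewrite mulrA ler_wpM2r// ltW.
  under eq_bigr do rewrite mulr_suml.
  rewrite exchange_big/= mulr_sumr; apply: ler_sum => m _.
  under [leLHS]eq_bigr do rewrite -mulrA.
  rewrite -mulr_sumr [leRHS]mulrCA ler_wpM2l//.
  by have /matrixP/(_ m 0) := Ax; rewrite !mxE => ->.
have sD : D s.
  exists (s%:C)%C => /=; last by rewrite expr0n/= addr0 sqrtr_sqr ger0_norm.
  apply/eigenvalueP; exists (map_mx (real_complex R) u).
    by rewrite -map_mxM uA rs map_mxZ.
  apply/eqP => /matrixP/(_ 0 (Ordinal n0)); rewrite !mxE => -[] /eqP.
  by rewrite gt_eqF.
apply/eqP; rewrite eq_le ge_sup ?andbT//; last by exists s.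
by rewrite ub_le_sup//; exists s.
Qed.

(** Subtracting the largest multiple of [x] that keeps the difference
    nonnegative leaves an eigenvector with a vanishing coordinate, which is zero
    because [A ^+ k] would otherwise make that coordinate positive. *)
Lemma Perron_simple n (A : 'M[R]_n) k r (x y : 'cV[R]_n) :
  (forall i j, 0 < (A ^+ k) i j) -> (forall j, 0 < x j 0) ->
  A *m x = r *: x -> A *m y = r *: y -> exists c, y = c *: x.
Proof.
move=> Ak0 x0 Ax Ay.
have [|n0] := posnP n.
  by move=> n0; exists 0; apply/matrixP => -[m mn]; exfalso; rewrite n0 in mn.
pose f j := y j 0 / x j 0.
pose j0 := [arg min_(j < Ordinal n0) f j]%O.
have fmin j : f j0 <= f j.
  by rewrite /j0; case: arg_minP => //= i _ -> .
exists (f j0); apply/eqP; rewrite -subr_eq0; set z := y - _.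
apply: contraT => zn0.
have zA : z^T *m A^T = r *: z^T.
  rewrite -trmx_mul -linearZ/= /z mulmxBr Ay -scalemxAr Ax scalerBr !scalerA.
  by rewrite mulrC.
have z0 j : 0 <= z^T 0 j.
  by rewrite !mxE subr_ge0 -ler_pdivlMr// fmin.
have Ak0' i j : 0 < (A^T ^+ k) i j by rewrite trmx_exp mxE.
have zn0' : z^T != 0 by apply: contraNneq zn0 => zE; rewrite -[z]trmxK zE trmx0.
have := mulmx_gt0 z0 zn0' Ak0' j0.
by rewrite (mulmx_exp_eigen _ zA) !mxE divfK ?gt_eqF// subrr mulr0 ltxx.
Qed.
End PerronFrobenius.

(** * The shifted toppling matrix *)

Section PerronTopple.
Variables (R : realType) (V : finType) (M : 'M[R]_#|V|).
Hypothesis V_gt0 : (0 < #|V|)%N.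
Hypothesis off_ge0 : forall v w : V, v != w -> 0 <= entry M v w.
Hypothesis M_irr : exists2 k : nat, (1 <= k)%N &
  forall v w : V, v != w -> 0 < entry ((M - diag_part M) ^+ k) v w.

Let N := M - diag_part M.
Let A := M + (alpha_of M)%:M.

Lemma sum_enum_rank (F : 'I_#|V| -> R) : \sum_i F i = \sum_v F (enum_rank v).
Proof. by rewrite (reindex enum_rank)//; apply: onW_bij; exact: enum_rank_bij. Qed.

Lemma alpha_diag v : 1 <= entry M v v + alpha_of M.
Proof.
suff : - entry M v v <= sup [set - entry M v v | v in [set: V]].
  by rewrite /alpha_of; lra.
apply: ub_le_sup; last by exists v.
exists (\sum_w `|entry M w w|) => _ [w _ <-].
rewrite (bigD1 w)//=; apply: ler_wpDr; first by rewrite sumr_ge0.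
by rewrite -normrN ler_norm.
Qed.

Lemma off_part_ge0 i j : 0 <= N i j.
Proof.
rewrite !mxE; have [->|ij] := eqVneq i j; first by rewrite mulr1n subrr.
rewrite mulr0n subr0; have := @off_ge0 (enum_val i) (enum_val j).
by rewrite /entry !enum_valK; apply; rewrite (inj_eq enum_val_inj).
Qed.

Lemma shifted_ge i j : (N + 1%:M) i j <= A i j.
Proof.
rewrite !mxE; have [->|ij] := eqVneq i j; last by rewrite !mulr0n subr0.
rewrite !mulr1n subrr add0r.
by have := alpha_diag (enum_val j); rewrite /entry !enum_valK.
Qed.

Lemma shifted_ge0 i j : 0 <= A i j.
Proof.
apply: le_trans (shifted_ge i j); rewrite mxE addr_ge0 ?off_part_ge0//.
by rewrite mxE; case: eqP.
Qed.

(** The diagonal of [A] is at least [1], so the powers of [A] dominate both the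
    identity and the powers of the off-diagonal part of [M]. *)
Lemma exp_shifted_ge k i j :
  [/\ 0 <= (N ^+ k) i j, (N ^+ k) i j <= (A ^+ k) i j,
      (1%:M : 'M[R]_#|V|) i j <= (A ^+ k) i j & 0 <= (A ^+ k) i j].
Proof.
elim: k i j => [|k IH] i j.
  by rewrite !expr0; split => //; rewrite mxE; case: eqP.
have N0 : 0 <= (N ^+ k.+1) i j.
  rewrite exprS; apply: mulmx_ge0 => [|a b]; first exact: off_part_ge0.
  by case: (IH a b).
have NA : (N ^+ k.+1) i j <= (A ^+ k.+1) i j.
  rewrite !exprS !mxE; apply: ler_sum => l _.
  have [h1 h2 h3 h4] := IH l j.
  apply: ler_pM => //; first exact: off_part_ge0.
  apply: le_trans (shifted_ge i l); rewrite [leRHS]mxE lerDl.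
  by rewrite mxE; case: eqP.
have A0 : 0 <= (A ^+ k.+1) i j by exact: le_trans NA.
split => //; have [->|ij] := eqVneq i j; last by rewrite mxE (negPf ij).
rewrite exprS [leRHS]mxE (bigD1 j)//= mxE eqxx.
apply: ler_wpDr.
  by rewrite sumr_ge0// => l _; rewrite mulr_ge0// ?shifted_ge0//; case: (IH l j).
have [_ _ h _] := IH j j.
rewrite -[leLHS]mulr1 ler_pM//; last by move: h; rewrite mxE eqxx.
apply: le_trans (shifted_ge j j); rewrite mxE [X in _ + X]mxE eqxx lerDr.
exact: off_part_ge0.
Qed.

Lemma exp_shifted_gt0 : exists k, forall i j, 0 < (A ^+ k) i j.
Proof.
have [k k1 Mk] := M_irr; exists k => i j.
have [h1 h2 h3 h4] := exp_shifted_ge k i j.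
have [ij|ij] := eqVneq i j; first by rewrite (lt_le_trans _ h3)// ij mxE eqxx.
apply: lt_le_trans h2; have := Mk (enum_val i) (enum_val j).
by rewrite /entry !enum_valK; apply; rewrite (inj_eq enum_val_inj).
Qed.

Lemma shifted_mul (b : V -> R) r : let y : 'cV_#|V| := \col_i b (enum_val i) in
  (A *m y = (r + alpha_of M) *: y) <->
  (forall v, \sum_w entry M v w * b w = r * b v).
Proof.
move=> y; have AyE v : (A *m y) (enum_rank v) 0 =
    \sum_w entry M v w * b w + alpha_of M * b v.
  rewrite mulmxDl mul_scalar_mx !mxE enum_rankK sum_enum_rank.
  by congr (_ + _); apply: eq_bigr => w _; rewrite mxE enum_rankK.
split=> [Ay v|My].
  have /matrixP/(_ (enum_rank v) 0) := Ay.
  rewrite AyE [RHS]mxE [in RHS]mxE enum_rankK [RHS]mulrDl.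
  by move=> h; apply: addIr h.
apply/matrixP => i j; rewrite ord1 -(enum_valK i) AyE My !mxE enum_rankK.
by rewrite [RHS]mulrDl.
Qed.

Lemma exists_Perron_vector : exists a : V -> R, [/\ forall v, 0 < a v,
  forall v, \sum_w entry M v w * a w = rho_of M * a v &
  forall b, (forall v, \sum_w entry M v w * b w = rho_of M * b v) ->
    exists c, forall v, b v = c * a v].
Proof.
have [k Ak0] := exp_shifted_gt0.
have [x [x0 Ax]] := spectral_radius_Perron V_gt0 shifted_ge0 Ak0.
pose a v := x (enum_rank v) 0.
have xE : x = \col_i a (enum_val i).
  by apply/matrixP => i j; rewrite mxE /a enum_valK ord1.
have rE : spectral_radius A = rho_of M + alpha_of M by rewrite /rho_of subrK.
exists a; split.
- by move=> v; exact: x0.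
- by apply/shifted_mul; rewrite -xE -rE.
- move=> b /shifted_mul; rewrite -rE => Ay.
  have [c yE] := Perron_simple Ak0 x0 Ax Ay; exists c => v.
  by have /matrixP/(_ (enum_rank v) 0) := yE; rewrite !mxE enum_rankK.
Qed.

(** Otherwise the off-diagonal part of [M], and hence all its powers, would
    have no entry from [U] to its complement. *)
Lemma irreducible_cut (U : pred V) v0 w0 : U v0 -> ~~ U w0 ->
  exists v w, [/\ U v, ~~ U w & 0 < entry M v w].
Proof.
move=> Uv Uw; apply: contrapT => nex.
have M0 v w : U v -> ~~ U w -> entry N v w = 0.
  move=> Uv' Uw'; have vw : v != w by apply: contraNneq Uw' => <-.
  have : entry M v w = 0.
    apply/eqP; rewrite eq_le off_ge0// andbT leNgt; apply/negP => Mvw.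
    by apply: nex; exists v, w.
  rewrite /N /entry !mxE (inj_eq enum_rank_inj) (negPf vw) mulr0n subr0.
  exact.
have Nk0 k v w : U v -> ~~ U w -> entry (N ^+ k) v w = 0.
  elim: k v w => [|k IH] v w Uv' Uw'.
    rewrite expr0 /entry mxE (inj_eq enum_rank_inj).
    by case: eqP => // vw; rewrite -vw Uv' in Uw'.
  rewrite exprS /entry mxE sum_enum_rank big1// => u _.
  have [Uu|Uu] := boolP (U u).
    by have := IH u w Uu Uw'; rewrite /entry => ->; rewrite mulr0.
  by have := M0 v u Uv' Uu; rewrite /entry => ->; rewrite mul0r.
have [k _ /(_ v0 w0)] := M_irr; rewrite -/N Nk0// ltxx.
by move=> vw; suff /vw : v0 != w0 by []; apply: contraNneq Uw => <-.
Qed.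
End PerronTopple.

(** * The Poisson equation of an irreducible chain *)

Section PoissonEquation.
Variables (R : realType) (T : finType) (P : T -> T -> R) (pi : T -> R).
Hypothesis stoP : stochastic P.
Hypothesis irrP : irreducible P.
Hypothesis statP : stationary P pi.

Lemma irreducible_closed (Q : T -> Prop) x : Q x ->
  (forall y z, Q y -> 0 < P y z -> Q z) -> forall y, Q y.
Proof.
move=> Qx Qcl y; have [n] := irrP x y; elim: n y => [|n IH] y.
  rewrite expr0 /entry mxE (inj_eq enum_rank_inj).
  by case: eqP => [<-//|_]; rewrite ltxx.
rewrite exprSr /entry mxE sum_enum_rank => sum_gt0.
have [z] : exists z, 0 < entry (fin_mx P ^+ n) x z * P z y.
  apply/existsP; apply: contraTT sum_gt0 => /existsPn nz.
  rewrite -leNgt; apply: sumr_le0 => z _; rewrite [X in _ * X]mxE !enum_rankK.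
  by rewrite leNgt; exact: nz.
have [Pzy|] := ltP 0 (P z y); first by rewrite pmulr_lgt0// => /IH/Qcl; apply.
have := stoP.1 z y; rewrite le_eqVlt => /orP[/eqP <-|]; last by rewrite ltNge => /negP.
by rewrite mulr0 ltxx.
Qed.

(** Maximum principle: an invariant function is maximal along every transition
    out of a maximiser. *)
Lemma invariant_const (f : T -> R) :
  (forall x, \sum_y P x y * f y = f x) -> forall x y, f x = f y.
Proof.
move=> Pf x0 y0.
pose m := [arg max_(x > x0) f x]%O.
have fm x : f x <= f m by rewrite /m; case: arg_maxP => //= i _ ->.
suff fE x : f x = f m by rewrite !fE.
apply: (@irreducible_closed (fun x => f x = f m) m) => // y z fy Pyz.
apply/eqP; rewrite eq_le fm leNgt; apply/negP => fz.
have : \sum_x P y x * (f m - f x) = 0.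
  under eq_bigr do rewrite mulrBr.
  by rewrite sumrB Pf -mulr_suml stoP.2 mul1r fy subrr.
apply/eqP; rewrite gt_eqF// (bigD1 z)//=; apply: ltr_pwDl.
  by rewrite mulr_gt0// subr_gt0.
by rewrite sumr_ge0// => w _; rewrite mulr_ge0 ?subr_ge0 ?stoP.1.
Qed.

(** The image of [1 - P] lies in the hyperplane orthogonal to [pi], and both
    have codimension one because the kernel of [1 - P] is the constants. *)
Lemma Poisson_equation (h : T -> R) : \sum_x pi x * h x = 0 ->
  exists f : T -> R, forall x, f x - \sum_y P x y * f y = h x.
Proof.
move=> ph; have [pi0 pi1 piP] := statP.
pose Q : 'M[R]_#|T| := 1%:M - (fin_mx P)^T.
pose p : 'cV[R]_#|T| := \col_i pi (enum_val i).
have rowQ (u : 'rV[R]_#|T|) x : (u *m Q) 0 (enum_rank x) =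
    u 0 (enum_rank x) - \sum_y P x y * u 0 (enum_rank y).
  rewrite mulmxBr mulmx1 !mxE; congr (_ - _); rewrite sum_enum_rank.
  by apply: eq_bigr => y _; rewrite !mxE !enum_rankK mulrC.
have Qp : (Q <= kermx p)%MS.
  apply/sub_kermxP/matrixP => i j; rewrite ord1 mulmxBl mul1mx !mxE.
  rewrite sum_enum_rank -(piP (enum_val i)) -sumrB big1// => x _.
  by rewrite !mxE !enum_rankK mulrC subrr.
have rp : (\rank p <= 1)%N by exact: rank_leq_col.
have p_neq0 : p != 0.
  apply/eqP => pE; move: pi1; rewrite big1 => [/eqP|x _].
    by rewrite eq_sym oner_eq0.
  by have /matrixP/(_ (enum_rank x) 0) := pE; rewrite !mxE enum_rankK.
have rp1 : \rank p = 1%N.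
  by apply/eqP; rewrite eqn_leq rp lt0n mxrank_eq0.
have kQ : (\rank (kermx Q) <= 1)%N.
  apply: leq_trans (rank_leq_row (const_mx 1 : 'rV[R]_#|T|)).
  apply: mxrankS; apply/row_subP => i.
  have /sub_kermxP uQ : (row i (kermx Q) <= kermx Q)%MS by exact: row_sub.
  set u := row i _ in uQ *; clearbody u.
  have [x _|T0] := pickP (fun _ : T => true); last first.
    have u0 : u = 0 by apply/matrixP => a j; have := T0 (enum_val j).
    by rewrite u0 sub0mx.
  have uc := @invariant_const (fun x => u 0 (enum_rank x)).
  apply/sub_rVP; exists (u 0 (enum_rank x)); apply/matrixP => a j.
  rewrite ord1 !mxE mulr1 -(enum_valK j); apply: uc => y.
  by have := rowQ u y; rewrite uQ mxE => /esym/eqP; rewrite subr_eq0 => /eqP.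
have rQ : (kermx p <= Q)%MS.
  have [_ <-] := mxrank_leqif_sup Qp; rewrite eqn_leq mxrankS//=.
  by move: kQ; rewrite !mxrank_ker rp1 !leq_subLR addnC.
have : ((\row_i h (enum_val i)) <= kermx p)%MS.
  apply/sub_kermxP/matrixP => a j; rewrite !mxE sum_enum_rank.
  rewrite -[RHS]ph; apply: eq_bigr => x _.
  by rewrite !mxE !enum_rankK mulrC.
move=> /submx_trans/(_ rQ)/submxP[u hE].
exists (fun x => u 0 (enum_rank x)) => x.
by have /matrixP/(_ 0 (enum_rank x)) := hE; rewrite rowQ mxE enum_rankK.
Qed.
End PoissonEquation.

(** * Sums over countable types *)

Section CountableSums.
Local Open Scope ereal_scope.
Variable R : realType.

(** Measures are sigma-additive along sequences: this turns a sum over a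
    countable type into a series. *)
Lemma esum_pickle (T : countType) (f : T -> \bar R) : (forall t, 0 <= f t) ->
  \esum_(t in [set: T]) f t =
  \sum_(n <oo) (if @pickle_inv T n is Some t then f t else 0).
Proof.
move=> f0; rewrite nneseries_esumT; last by move=> n; case: pickle_inv.
pose g n := if @pickle_inv T n is Some t then f t else 0.
rewrite (_ : \esum_(n in [set: nat]) _ = \esum_(n in range (@pickle T)) g n).
  rewrite (reindex_esum [set: T] _ (@pickle T)).
    by apply: eq_esum => t _; rewrite /g pickleK_inv.
  by apply: inj_bij => x y _ _; exact: (pcan_inj pickleK_inv).
rewrite [RHS]esum_mkcond; apply: eq_esum => n _; rewrite /g.
case: ifPn => //; apply: contraNeq => gn; rewrite inE.
case: pickle_inv (@pickle_invK T n) gn => [t /= <- _|]; last by rewrite eqxx.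
by exists t.
Qed.

Lemma esumZl (T : countType) (f : T -> \bar R) (c : R) : (forall t, 0 <= f t) ->
  (0 <= c)%R ->
  \esum_(t in [set: T]) (c%:E * f t) = c%:E * \esum_(t in [set: T]) f t.
Proof.
move=> f0 c0; rewrite !esum_pickle//; last by move=> t; rewrite mule_ge0.
rewrite -nneseriesZl; last by move=> n _; case: pickle_inv.
by apply: eq_eseriesr => n _; case: pickle_inv => //; rewrite mule0.
Qed.

Lemma esum_swap (T1 T2 : choiceType) (f : T1 -> T2 -> \bar R) :
  (forall x y, 0 <= f x y) ->
  \esum_(x in [set: T1]) \esum_(y in [set: T2]) f x y =
  \esum_(y in [set: T2]) \esum_(x in [set: T1]) f x y.
Proof.
move=> f0; rewrite !esum_esum//.
rewrite (reindex_esum ([set: T2] `*`` (fun=> [set: T1])) _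
  (fun p : T2 * T1 => (p.2, p.1)))//.
split => //=.
- by move=> [x1 y1] [x2 y2] /= _ _ [-> ->].
- by move=> [x y] _; exists (y, x).
Qed.

Lemma esum_ge_seq (T : choiceType) (s : seq T) (f : T -> \bar R) : uniq s ->
  (forall t, 0 <= f t) -> \sum_(t <- s) f t <= \esum_(t in [set: T]) f t.
Proof.
move=> us f0; rewrite esum_ge//; exists [set` s]; last by rewrite fsbig_seq.
by split => //; exact: finite_seq.
Qed.

Lemma esum_ge1 (T : choiceType) (f : T -> \bar R) t :
  (forall t, 0 <= f t) -> f t <= \esum_(t in [set: T]) f t.
Proof. by move=> /(@esum_ge_seq _ [:: t] _ isT); rewrite big_seq1. Qed.

Lemma esum_supp_seq (T : choiceType) (s : seq T) (f : T -> \bar R) : uniq s ->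
  (forall t, 0 <= f t) -> (forall t, t \notin s -> f t = 0) ->
  \esum_(t in [set: T]) f t = \sum_(t <- s) f t.
Proof.
move=> us f0 fs; rewrite fsbig_seq// -esum_fset//.
rewrite [RHS]esum_mkcond; apply: eq_esum => t _; case: ifPn => //.
by rewrite notin_setE => /negP /fs.
Qed.

Lemma esum_eq0P (T : choiceType) (f : T -> \bar R) : (forall t, 0 <= f t) ->
  \esum_(t in [set: T]) f t = 0 -> forall t, f t = 0.
Proof.
move=> f0 sum0 t; apply/eqP; rewrite eq_le f0 andbT -sum0.
exact: esum_ge1.
Qed.

Section fibers.
Context d (Om : measurableType d) (mu : {measure set Om -> \bar R}).
Context (T : countType) (F : T -> set Om).
Hypothesis mF : forall t, measurable (F t).
Hypothesis tF : trivIset setT F.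

Let G n := if @pickle_inv T n is Some t then F t else set0.

Let mG n : measurable (G n). Proof. by rewrite /G; case: pickle_inv. Qed.

Let tG : trivIset setT G.
Proof.
move=> i j _ _; rewrite /G.
case: pickle_inv (@pickle_invK T i) => [t /= <-|_]; last by case=> x [].
case: pickle_inv (@pickle_invK T j) => [u /= <-|_]; last by case=> x [].
by move=> /tF ->.
Qed.

Let GF : \bigcup_n G n = \bigcup_t F t.
Proof.
apply/seteqP; split=> x [i _]; rewrite /G.
  by case: pickle_inv => // t Ft; exists t.
by move=> Fx; exists (pickle i) => //; rewrite pickleK_inv.
Qed.

Lemma ge0_integral_fibers (f : Om -> \bar R) :
  \bigcup_t F t = [set: Om] -> measurable_fun setT f -> (forall x, 0 <= f x) ->
  \int[mu]_x f x = \esum_(t in [set: T]) \int[mu]_(x in F t) f x.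
Proof.
move=> FT mf f0; rewrite -FT -GF ge0_integral_bigcup ?GF ?FT// esum_pickle.
  apply: eq_eseriesr => n _; rewrite /G; case: pickle_inv => //.
  by rewrite integral_set0.
by move=> t; exact: integral_ge0.
Qed.

Lemma measure_fibers : mu (\bigcup_t F t) = \esum_(t in [set: T]) mu (F t).
Proof.
rewrite -GF measure_bigcup//.
rewrite esum_pickle//.
rewrite eseries_mkcond; apply: eq_eseriesr => n _; rewrite in_setT /G.
by case: pickle_inv => //; rewrite measure0.
Qed.
End fibers.
End CountableSums.

(** * Markov chains on a countable type *)

Section MarkovChain.
Local Open Scope ereal_scope.
Context (R : realType) (T : countType) (p : T -> T -> R).
Hypothesis p_ge0 : forall x y, (0 <= p x y)%R.
Context d (Om : measurableType d) (P : probability Om R) (X : nat -> Om -> T).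
Hypothesis mX : forall n x, measurable [set w | X n w = x].
Hypothesis markovX : forall n (x : nat -> T),
  P [set w | forall i, (i <= n.+1)%N -> X i w = x i] =
  P [set w | forall i, (i <= n)%N -> X i w = x i] * (p (x n) (x n.+1))%:E.

Let seg (x : nat -> T) k n := [set w | forall i, (k <= i <= n)%N -> X i w = x i].

Let mseg x k n : measurable (seg x k n).
Proof.
rewrite (_ : seg x k n =
    \bigcap_(i in [set i | (k <= i <= n)%N]) [set w | X i w = x i])//.
by apply: bigcap_measurableType => i _; exact: mX.
Qed.

Lemma measure_value n (A : set Om) : measurable A ->
  P A = \esum_(y in [set: T]) P (A `&` [set w | X n w = y]).
Proof.
move=> mA; rewrite -(@measure_fibers _ _ _ P T (fun y => A `&` _)).
- rewrite -setI_bigcupr (_ : \bigcup_t _ = setT) ?setIT//.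
  by apply/seteqP; split=> // w _; exists (X n w).
- by move=> y; apply: measurableI.
- by move=> i j _ _ [w [[_ <-] [_ <-]]].
Qed.

(** Summing out the earliest coordinate reduces the Markov property for whole
    trajectories to the one for two consecutive states. *)
Lemma markov_segment k n x : (k <= n)%N ->
  P (seg x k n.+1) = P (seg x k n) * (p (x n) (x n.+1))%:E.
Proof.
elim: k x => [|k IH] x kn; first exact: markovX.
pose upd y i := if i == k then y else x i.
have segE y m : (k <= m)%N ->
    seg x k.+1 m `&` [set w | X k w = y] = seg (upd y) k m.
  move=> km; apply/seteqP; split=> w /=.
    move=> [xw kw] i /andP[ki im]; rewrite /upd; case: eqVneq => [->//|ik].
    by apply: xw; rewrite im andbT ltn_neqAle eq_sym ik.
  move=> xw; split=> [i /andP[ki im]|].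
    by have := xw i; rewrite (ltnW ki) im /upd gtn_eqF//; apply.
  by have := xw k; rewrite leqnn km /upd eqxx; apply.
rewrite !(measure_value k (mseg _ _ _)) muleC -esumZl//.
apply: eq_esum => y _; rewrite !segE ?(leq_trans (ltnW kn))//.
  by rewrite IH ?(ltnW kn)// muleC /upd !gtn_eqF// ltnW.
Qed.

Definition marginal n x := P [set w | X n w = x].

Lemma marginal_ge0 n x : 0 <= marginal n x. Proof. exact: measure_ge0. Qed.

Lemma two_step n x y :
  P [set w | X n w = x /\ X n.+1 w = y] = marginal n x * (p x y)%:E.
Proof.
pose z i := if i == n then x else y.
have := @markov_segment n n z (leqnn n).
have zn : z n = x by rewrite /z eqxx.
have zS : z n.+1 = y by rewrite /z gtn_eqF.
rewrite zn zS (_ : seg z n n = [set w | X n w = x]).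
  move=> <-; congr (P _); apply/seteqP; split=> w /=.
    move=> [wx wy] i; rewrite -ltnS ltnS => /andP[ni]; rewrite leq_eqVlt.
    move=> /orP[/eqP->|]; first by rewrite zS.
    rewrite ltnS => ni'; rewrite (_ : i = n) ?zn//.
    by apply/eqP; rewrite eqn_leq ni'.
  move=> wz; have := wz n; have := wz n.+1.
  by rewrite !leqnn leqnSn zn zS; split; auto.
apply/seteqP; split=> w /=.
  move=> /(_ n); rewrite leqnn zn; exact.
by move=> wx i ni; rewrite (_ : i = n) ?zn//; apply/eqP; rewrite eqn_leq andbC.
Qed.

Lemma marginalS n y :
  marginal n.+1 y = \esum_(x in [set: T]) (marginal n x * (p x y)%:E).
Proof.
rewrite /marginal (measure_value n)//; apply: eq_esum => x _.
rewrite -two_step; congr (P _).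
by apply/seteqP; split=> w [].
Qed.

Definition expect n (f : T -> \bar R) := \esum_(x in [set: T]) (marginal n x * f x).

Definition transfer (f : T -> R) x := \esum_(y in [set: T]) (p x y * f y)%:E.

Lemma le_transfer f g x : (forall y, (0 < p x y)%R -> (f y <= g y)%R) ->
  transfer f x <= transfer g x.
Proof.
move=> fg; apply: le_esum => y _; rewrite lee_fin.
have := p_ge0 x y; rewrite le_eqVlt => /orP[/eqP <-|pxy]; first by rewrite !mul0r.
by rewrite ler_pM2l// fg.
Qed.

Lemma expectS n f : (forall x, (0 <= f x)%R) ->
  expect n.+1 (EFin \o f) = expect n (transfer f).
Proof.
move=> f0; rewrite /expect /transfer.
transitivity (\esum_(y in [set: T]) \esum_(x in [set: T])
    (marginal n x * (p x y * f y)%:E)).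
  apply: eq_esum => y _; rewrite marginalS muleC -esumZl//; last first.
    by move=> x; rewrite mule_ge0// lee_fin.
  by apply: eq_esum => x _; rewrite muleCA -EFinM mulrC.
rewrite esum_swap; last by move=> y x; rewrite mule_ge0// lee_fin mulr_ge0.
apply: eq_esum => x _.
have mfin : marginal n x \is a fin_num by exact: fin_num_measure.
rewrite -(fineK mfin) esumZl//; last by rewrite fine_ge0.
by move=> y; rewrite lee_fin mulr_ge0.
Qed.

Lemma measurable_event n (B : T -> Prop) : measurable [set w | B (X n w)].
Proof.
rewrite (_ : [set w | _] = \bigcup_(x in [set x | B x]) [set w | X n w = x]).
  rewrite bigcup_mkcond; apply: countable_bigcupT_measurable => // x.
  by case: ifP.
by apply/seteqP; split=> w /=; [move=> Bw; exists (X n w)|move=> [x Bx /= ->]].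
Qed.

Lemma measure_expect n (B : pred T) :
  P [set w | B (X n w)] = expect n (fun x => ((B x)%:R : R)%:E).
Proof.
have mB := measurable_event n B.
rewrite (measure_value n mB); apply: eq_esum => x _.
have [Bx|Bx] := boolP (B x).
  rewrite mule1; congr (P _); apply/seteqP; split=> w; first by case.
  by move=> /= wx; rewrite wx.
rewrite mule0 (_ : _ `&` _ = set0) ?measure0//.
by apply/seteqP; split=> w //= -[Bw wx]; rewrite -wx Bw in Bx.
Qed.

Section comparison.
Variables (x0 : T) (G : T -> Prop).
Hypothesis X0 : {ae P, forall w, X 0%N w = x0}.
Hypothesis Gx0 : G x0.
Hypothesis G_closed : forall x y, G x -> (0 < p x y)%R -> G y.

Lemma marginal0 x : marginal 0 x = ((x == x0)%:R : R)%:E.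
Proof.
have [->|xx0] := eqVneq x x0.
  have nA : P (~` [set w | X 0%N w = x0]) = 0.
    by apply/negligibleP; [exact: measurableC|exact: X0].
  rewrite /marginal -[[set w | _]]setCK probability_setC ?nA ?sube0//.
  exact: measurableC.
apply/negligibleP; first exact: mX.
apply: negligibleS X0 => w /= wx; rewrite wx.
exact/eqP.
Qed.

Lemma marginal_supp n x : ~ G x -> marginal n x = 0.
Proof.
elim: n x => [|n IH] x nGx.
  by rewrite marginal0; case: eqP => // xE; rewrite xE in nGx.
rewrite marginalS esum1// => y _; have [Gy|nGy] := pselect (G y).
  have := p_ge0 y x; rewrite le_eqVlt => /orP[/eqP <-|pyx]; first by rewrite mule0.
  by exfalso; exact: nGx (G_closed Gy pyx).
by rewrite IH// mul0e.
Qed.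

(** Comparison principle: [u m] is an upper bound for the value of [f] after [m]
    further steps, so the expectation of [u (n - k)] after [k] steps decreases
    in [k]. *)
Lemma expect_le f (u : nat -> T -> R) n : (forall x, (0 <= f x)%R) ->
  (forall m x, (0 <= u m x)%R) -> (forall x, G x -> (f x <= u 0%N x)%R) ->
  (forall m x, G x -> transfer (u m) x <= (u m.+1 x)%:E) ->
  expect n (EFin \o f) <= (u n x0)%:E.
Proof.
move=> f0 u0 fu uS.
have mono k (g h : T -> \bar R) : (forall x, G x -> g x <= h x) ->
    expect k g <= expect k h.
  move=> gh; apply: le_esum => x _; have [Gx|nGx] := pselect (G x).
    by apply: lee_wpmul2l; [exact: marginal_ge0|exact: gh].
  by rewrite marginal_supp// !mul0e.
suff step k m : expect k (EFin \o u m) <= (u (k + m)%N x0)%:E.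
  apply: (le_trans (mono n _ (EFin \o u 0%N) _)); last first.
    by have := step n 0%N; rewrite addn0.
  by move=> x Gx /=; rewrite lee_fin fu.
elim: k m => [|k IH] m.
  rewrite add0n /expect (@esum_supp_seq _ _ [:: x0])//.
  - by rewrite big_seq1 marginal0 eqxx mul1e.
  - by move=> x; rewrite mule_ge0// lee_fin.
  - by move=> x; rewrite inE => /negPf xx0; rewrite marginal0 xx0 mul0e.
rewrite expectS// addSnnS; apply: le_trans (IH m.+1).
by apply: mono => x Gx; exact: uS.
Qed.
End comparison.
End MarkovChain.

(** * Almost sure properties of transitions *)

Section Transitions.
Local Open Scope ereal_scope.
Context (R : realType) (T : countType) (p : T -> T -> R).
Hypothesis p_ge0 : forall x y, (0 <= p x y)%R.
Context d (Om : measurableType d) (P : probability Om R) (X : nat -> Om -> T).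
Hypothesis mX : forall n x, measurable [set w | X n w = x].
Hypothesis markovX : forall n (x : nat -> T),
  P [set w | forall i, (i <= n.+1)%N -> X i w = x i] =
  P [set w | forall i, (i <= n)%N -> X i w = x i] * (p (x n) (x n.+1))%:E.

Lemma ae_transition (Q : T -> T -> Prop) :
  (forall x y, (0 < p x y)%R -> Q x y) ->
  {ae P, forall w, forall n, Q (X n w) (X n.+1 w)}.
Proof.
move=> pQ; apply: ae_foralln => n.
pose Y (_ : nat) w := (X n w, X n.+1 w).
have YE z : [set w | Y 0%N w = z] = [set w | X n w = z.1 /\ X n.+1 w = z.2].
  by apply/seteqP; split=> w; case: z => x y /=; [case|case=> <- <-].
have mY (k : nat) z : measurable [set w | Y k w = z].
  by rewrite (YE z); apply: measurableI; exact: mX.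
have mB := measurable_event mY 0%N (fun z => ~ Q z.1 z.2).
apply/negligibleP => //; apply: (etrans (measure_value P mY 0%N mB)).
rewrite esum1// => z _.
have [/pQ Qz|] := ltP 0%R (p z.1 z.2).
  rewrite (_ : _ `&` _ = set0) ?measure0//.
  by apply/seteqP; split=> w // -[nQ /= Yz]; apply: nQ; move: Qz; rewrite -Yz.
move=> pz; have {}pz : p z.1 z.2 = 0%R by apply/eqP; rewrite eq_le pz p_ge0.
apply/eqP; rewrite eq_le measure_ge0 andbT.
apply: (@le_trans _ _ (P [set w | X n w = z.1 /\ X n.+1 w = z.2])).
  rewrite -YE; apply: le_measure; rewrite ?inE; last by move=> w [].
    by apply: measurableI.
  exact: mY.
by rewrite (two_step p_ge0 mX markovX) pz mule0.
Qed.

Lemma ae_first_step x0 y (Q : T -> Prop) : {ae P, forall w, X 0%N w = x0} ->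
  {ae P, forall w, Q (X 1%N w)} -> (0 < p x0 y)%R -> Q y.
Proof.
move=> X0 Q1 pxy; apply: contrapT => nQy.
have : marginal P X 1 y = 0.
  apply/negligibleP; first exact: mX.
  by apply: negligibleS Q1 => w /= wy; rewrite wy.
rewrite (marginalS p_ge0 mX markovX) => /esum_eq0P-/(_ _ x0).
rewrite (marginal0 mX X0) eqxx mul1e => h.
suff : (p x0 y)%:E = 0 by move=> [] p0; rewrite p0 ltxx in pxy.
by apply: h => x; rewrite mule_ge0// lee_fin.
Qed.
End Transitions.

(** * Absorption of a chain without finite traps *)

Lemma finite_argmin (R : realType) (T : eqType) (D : T -> Prop) (s : seq T)
    (f : T -> R) :
  (exists x, D x) -> (forall x, D x -> x \in s) ->
  exists2 x, D x & forall y, D y -> f x <= f y.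
Proof.
move=> [x0 Dx0] Ds.
suff [x Dx xmin] : exists2 x, D x & forall y, y \in s -> D y -> f x <= f y.
  by exists x => // y Dy; apply: xmin => //; exact: Ds.
elim: (s) => [|a r [x Dx xmin]]; first by exists x0.
have [[Da ax]|nax] := pselect (D a /\ f a <= f x).
  exists a => // y; rewrite inE => /orP[/eqP->//|yr Dy].
  exact: le_trans ax (xmin _ yr Dy).
exists x => // y; rewrite inE => /orP[/eqP-> Da|]; last exact: xmin.
by rewrite leNgt; apply/negP => ax; apply: nax; split=> //; exact: ltW.
Qed.

Section Traps.
Context (R : realType) (T : countType) (p : T -> T -> R).
Hypothesis p_ge0 : forall x y, 0 <= p x y.
Variables (G : T -> Prop) (A : pred T).
Hypothesis transfer1 : forall x, G x -> transfer p (fun=> 1) x = 1%:E.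

(** [G] stands for the states that the chain can visit and [A] for the absorbing
    ones: traps are the obstruction to absorption. *)
Definition trap (D : T -> Prop) :=
  [/\ exists x, D x, exists s : seq T, forall x, D x -> x \in s,
      forall x, D x -> G x /\ ~~ A x &
      forall x y, D x -> 0 < p x y -> D y].

(** Finiteness of traps makes the descent to smaller traps stop. *)
Lemma trap_minimal D : trap D -> exists2 C : T -> Prop, trap C &
  (forall x, C x -> D x) /\
  forall C', trap C' -> (forall x, C' x -> C x) -> forall x, C x -> C' x.
Proof.
move=> tD; have [_ [s Ds] _ _] := tD; move: {2}(size s) (leqnn (size s)) => n.
elim: n s D tD Ds => [|n IH] s D tD Ds sn.
  have [[x /Ds]] := tD; move: sn; rewrite leqn0 => /nilP ->.
  by rewrite in_nil.
have [Dmin|] := pselect (forall C', trap C' -> (forall x, C' x -> D x) ->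
    forall x, D x -> C' x); first by exists D.
move=> /existsNP[C' /not_implyP[tC' /not_implyP[C'D /existsNP[x]]]].
move=> /not_implyP[Dx nC'x].
have xs := Ds _ Dx.
have C's y : C' y -> y \in [seq y <- s | y != x].
  move=> C'y; rewrite mem_filter (Ds _ (C'D _ C'y)) andbT.
  by apply/eqP => yx; apply: nC'x; rewrite -yx.
have [|C tC [CC' Cmin]] := IH _ _ tC' C's.
  rewrite -ltnS; apply: leq_trans sn.
  rewrite size_filter -(count_predC (pred1 x) s) -addn1 addnC leq_add2r.
  by rewrite -has_count has_pred1.
by exists C => //; split => // y /CC'/C'D.
Qed.

Lemma transferD f g x : (forall y, 0 <= f y) -> (forall y, 0 <= g y) ->
  transfer p (fun y => f y + g y) x = (transfer p f x + transfer p g x)%E.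
Proof.
move=> f0 g0; rewrite /transfer -esumD => [||y _]; rewrite ?lee_fin ?mulr_ge0//.
- by apply: eq_esum => y _; rewrite mulrDr.
- by move=> y _; rewrite lee_fin mulr_ge0.
Qed.

Lemma transferZ f c x : (forall y, 0 <= f y) -> 0 <= c ->
  transfer p (fun y => c * f y) x = (c%:E * transfer p f x)%E.
Proof.
move=> f0 c0; rewrite /transfer -esumZl// => [|y]; last by rewrite lee_fin mulr_ge0.
by apply: eq_esum => y _; rewrite -EFinM mulrCA.
Qed.

Lemma transfer_cst c x : G x -> 0 <= c -> transfer p (fun=> c) x = c%:E.
Proof.
move=> Gx c0; rewrite (_ : (fun=> c) = (fun y => c * 1)).
  by rewrite transferZ// transfer1// mule1.
by apply/funext => y; rewrite mulr1.
Qed.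

(** Minimum principle: at a minimiser of a superharmonic [Z] the average over
    the successors is both at least and at most the minimum, so [Z] is minimal at
    every successor and the minimisers form a trap themselves. *)
Lemma trap_argmin D (Z : T -> R) : trap D -> (forall x, 0 <= Z x) ->
  (forall x, D x -> (transfer p Z x <= (Z x)%:E)%E) ->
  exists m, trap (fun x => D x /\ Z x = m) /\
    forall x, D x -> Z x = m -> transfer p Z x = (Z x)%:E.
Proof.
move=> [D0 [s Ds] DG Dcl] Z0 Zsup.
have [x Dx xmin] := finite_argmin Z D0 Ds.
have Zge z : D z -> Z z = Z x -> ((Z x)%:E <= transfer p Z z)%E.
  move=> Dz zx; rewrite -(transfer_cst (DG _ Dz).1 (Z0 x)).
  by apply: le_transfer => // y pzy; apply: xmin; exact: Dcl pzy.
exists (Z x); split; last first.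
  by move=> z Dz zx; apply/eqP; rewrite eq_le Zsup// zx Zge.
split; [by exists x|by exists s => y []; auto|by move=> y []; auto|].
move=> y z [Dy Zy] pyz; have Dz := Dcl _ _ Dy pyz; split => //.
apply/eqP; rewrite eq_le xmin// andbT leNgt; apply/negP => xz.
have := Zsup y Dy; rewrite Zy leNgt => /negP; apply.
apply: (@lt_le_trans _ _ (transfer p (fun w => Z x + (Z z - Z x) * (w == z)%:R) y)).
  rewrite transferD// => [|w]; last by rewrite mulr_ge0// subr_ge0 ltW.
  rewrite transferZ// ?subr_ge0; last exact: ltW.
  rewrite (transfer_cst (DG _ Dy).1)// lteDl// mule_gt0// ?lte_fin ?subr_gt0//.
  apply: lt_le_trans (@esum_ge1 _ _ _ z _) => [|w]; last by rewrite lee_fin mulr_ge0.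
  by rewrite eqxx mulr1 lte_fin.
apply: le_transfer => // w pyw; have [->|wz] := eqVneq w z.
  by rewrite mulr1 addrC subrK.
by rewrite mulr0 addr0; apply: xmin; exact: Dcl pyw.
Qed.

Section stay.
Variable F : seq T.
Hypotheses (uF : uniq F) (FG : forall x, x \in F -> G x /\ ~~ A x).

(** The chain killed on leaving [F]: the probability of staying in [F] during
    [n] steps. *)
Fixpoint stay n x : R :=
  if x \in F then
    if n is n'.+1 then \sum_(y <- F) p x y * stay n' y else 1
  else 0.

Lemma sum_p_le1 x s : G x -> uniq s -> \sum_(y <- s) p x y <= 1.
Proof.
move=> Gx us; rewrite -lee_fin -(transfer1 Gx) -sumEFin.
rewrite /transfer; under [leRHS]eq_esum do rewrite mulr1.
by apply: esum_ge_seq => // y; rewrite lee_fin.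
Qed.

Lemma stay_notin n x : x \notin F -> stay n x = 0.
Proof. by case: n => [|n] /= /negPf ->. Qed.

Lemma stay_bounds n x : 0 <= stay n x <= 1.
Proof.
elim: n x => [|n IH] x /=; case: ifP => // xF; rewrite ?lexx ?ler01//.
rewrite sumr_ge0/=; last by move=> y _; rewrite mulr_ge0//; case/andP: (IH y).
apply: le_trans (sum_p_le1 (FG xF).1 uF); apply: ler_sum => y _.
by rewrite ler_piMr//; case/andP: (IH y).
Qed.

Lemma stay_decr n x : stay n.+1 x <= stay n x.
Proof.
elim: n x => [|n IH] x.
  have [xF|xF] := boolP (x \in F); last by rewrite !stay_notin.
  by rewrite [leRHS]/= xF; case/andP: (stay_bounds 1 x).
rewrite [leRHS]/= [leLHS]/=; case: ifP => // xF.
by apply: ler_sum => y _; rewrite ler_wpM2l//; exact: IH.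
Qed.

(** The limit is harmonic for the killed chain; where it attains a positive
    maximum the chain loses no mass and moves only to other maximisers, which
    would thus form a trap. *)
Lemma stay_cvg x : (forall D, ~ trap D) -> (fun n => stay n x) @ \oo --> 0.
Proof.
move=> notrap.
pose f x := limn (fun n => stay n x).
have sf y : (fun n => stay n y) @ \oo --> f y.
  apply: nonincreasing_is_cvgn.
    by apply/nonincreasing_seqP => n; exact: stay_decr.
  by exists 0 => _ [n _ <-]; case/andP: (stay_bounds n y).
have f0 y : 0 <= f y.
  by apply: limr_ge; [exact: sf|apply: nearW => n; case/andP: (stay_bounds n y)].
have fF y : y \notin F -> f y = 0.
  move=> yF; rewrite /f (_ : (fun n => _) = cst 0) ?lim_cst//.
  by apply/funext => n; rewrite stay_notin.
have fharm y : y \in F -> f y = \sum_(z <- F) p y z * f z.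
  move=> yF.
  have shift : (fun n => stay n.+1 y) @ \oo --> f y.
    by rewrite (cvg_shiftS (fun n => stay n y)); exact: sf.
  rewrite -(cvg_lim (@Rhausdorff R) shift); apply: (cvg_lim (@Rhausdorff R)).
  rewrite (_ : (fun n => stay n.+1 y) =
    (fun n => \sum_(z <- F) p y z * stay n z)); last first.
    by apply/funext => n /=; rewrite yF.
  apply: cvg_big => [|z _]; first by move=> [a b]; exact: add_continuous.
  by apply: cvgMr; exact: sf.
suff fE y : f y = 0 by rewrite -(fE x); exact: sf.
apply/eqP; apply: contrapT => /negP fy.
have yF : y \in F by apply: contraNT fy => /fF ->.
have [||z zF zmax] := @finite_argmin R T (fun x => x \in F) F (fun x => - f x).
- by exists y.
- by [].
have fz0 : 0 < f z.
  apply: (@lt_le_trans _ _ (f y)); first by rewrite lt0r fy f0.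
  by rewrite -lerN2 zmax.
apply: (notrap (fun x => x \in F /\ f x = f z)); split.
- by exists z.
- by exists F => w [].
- by move=> w [wF _]; exact: FG.
move=> w1 w2 [w1F fw1] pw.
have fle w : f w <= f z.
  have [wF|/fF->] := boolP (w \in F); last exact: ltW.
  by rewrite -lerN2 zmax.
suff fw2 : f w2 = f z.
  by split => //; apply: contraT => /fF w20; move: fz0; rewrite -fw2 w20 ltxx.
pose F' := undup (w2 :: F).
have : \sum_(v <- F') p w1 v * (f z - f v) <= 0.
  under eq_bigr do rewrite mulrBr.
  rewrite sumrB -mulr_suml subr_le0.
  have -> : \sum_(v <- F') p w1 v * f v = f z.
    rewrite -fw1 fharm// /F' /=; case: ifP => [_|w2F].
      by rewrite undup_id.
    by rewrite undup_id// big_cons fF ?w2F// mulr0 add0r.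
  apply: ler_piMl; first exact: ltW.
  by apply: sum_p_le1; [exact: (FG w1F).1|exact: undup_uniq].
move=> sle; apply/eqP; rewrite eq_le fle leNgt; apply/negP => fw2.
move: sle; apply/negP; rewrite -ltNge.
rewrite (bigD1_seq w2) ?undup_uniq ?mem_undup ?mem_head//=.
apply: ltr_pwDl; first by rewrite mulr_gt0// subr_gt0.
by apply: sumr_ge0 => v _; rewrite mulr_ge0// subr_ge0.
Qed.
End stay.

Section Lyapunov.
Variable Z : T -> R.
Hypothesis Z_ge0 : forall x, 0 <= Z x.
Hypothesis Z_super : forall x, G x -> ~~ A x -> (transfer p Z x <= (Z x)%:E)%E.
Hypothesis Z_proper : forall K, exists s : seq T,
  forall x, G x -> ~~ A x -> Z x < K -> x \in s.
Hypothesis A_absorbing : forall x y, A x -> 0 < p x y -> y = x.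
Hypothesis no_trap : forall D, ~ trap D.

Context d (Om : measurableType d) (P : probability Om R) (X : nat -> Om -> T).
Hypothesis mX : forall n x, measurable [set w | X n w = x].
Hypothesis markovX : forall n (x : nat -> T),
  (P [set w | forall i, (i <= n.+1)%N -> X i w = x i] =
  P [set w | forall i, (i <= n)%N -> X i w = x i] * (p (x n) (x n.+1))%:E)%E.
Variable x0 : T.
Hypothesis X0 : {ae P, forall w, X 0%N w = x0}.
Hypothesis Gx0 : G x0.
Hypothesis G_closed : forall x y, G x -> 0 < p x y -> G y.

(** Before absorption the chain either stays in the finite set [Z < K], which
    has probability tending to zero, or it leaves that set, which has
    probability at most [Z x0 / K]. *)
Lemma Lyapunov_absorbed : {ae P, forall w, exists n, A (X n w)}.
Proof.
pose U n := [set w | ~~ A (X n w)].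
have mU n : measurable (U n) by exact: (measurable_event mX n (fun x => ~~ A x)).
have Ubound K : 0 < K -> exists F : seq T, [/\ uniq F,
   forall x, x \in F -> G x /\ ~~ A x &
   forall n, (P (U n) <= (stay F n x0 + Z x0 / K)%:E)%E].
  move=> K0; have [s Zs] := Z_proper K.
  pose F := undup [seq x <- s | `[< G x /\ ~~ A x /\ Z x < K >]].
  have uF : uniq F by exact: undup_uniq.
  have memF x : x \in F <-> G x /\ ~~ A x /\ Z x < K.
    rewrite mem_undup mem_filter; split; first by move=> /andP[/asboolP].
    by move=> h; rewrite asboolT//=; case: h => ? [? ?]; exact: Zs.
  have FG x : x \in F -> G x /\ ~~ A x by move=> /memF[? []].
  exists F; split => // n.
  (* [u] bounds from above the probability of not being absorbed. *)
  pose u n x : R := if A x then 0 else Num.min 1 (stay F n x + Z x / K).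
  have stay0 m x : 0 <= stay F m x by case/andP: (stay_bounds uF FG m x).
  have ZK0 x : 0 <= Z x / K by rewrite divr_ge0// ltW.
  have KZ1 m x : K <= Z x -> 1 <= stay F m x + Z x / K.
    by move=> KZ; apply: ler_wpDl => //; rewrite ler_pdivlMr// mul1r.
  have u0 m x : 0 <= u m x.
    by rewrite /u; case: ifP => // _; rewrite le_min ler01 addr_ge0.
  have u1 m x : u m x <= 1.
    by rewrite /u; case: ifP => // _; rewrite ge_min lexx.
  apply: (@le_trans _ _ (u n x0)%:E); last first.
    by rewrite lee_fin /u; case: ifP => _; rewrite ?addr_ge0// ge_min lexx orbT.
  rewrite /U (measure_expect P mX n (fun x => ~~ A x)).
  apply: (expect_le p_ge0 mX markovX X0 Gx0 G_closed) => //.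
  - move=> x Gx; rewrite /u; case: ifPn => // Ax; rewrite [leLHS]/= le_min lexx andTb.
    have [ZK|KZ] := ltP (Z x) K; last exact: KZ1.
    have xF : x \in F by apply/memF.
    by rewrite /= xF lerDl.
  - move=> m x Gx; have [Ax|nAx] := boolP (A x).
      rewrite /transfer esum1 ?lee_fin// => y _.
      have := p_ge0 x y; rewrite le_eqVlt => /orP[/eqP <-|/(A_absorbing Ax) ->].
        by rewrite mul0r.
      by rewrite /u Ax mulr0.
    have le1 : (transfer p (u m) x <= 1%:E)%E.
      by rewrite -(transfer1 Gx); exact: le_transfer.
    rewrite [in leRHS]/u (negPf nAx) EFin_min le_min le1 andTb.
    have [ZK|KZ] := ltP (Z x) K; last first.
      by apply: le_trans le1 _; rewrite lee_fin; exact: (KZ1 m.+1).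
    have xF : x \in F by apply/memF.
    apply: (@le_trans _ _ (transfer p (fun y => stay F m y + K^-1 * Z y) x)).
      apply: le_transfer => // y _; rewrite /u; case: ifP => _.
        by rewrite addr_ge0// mulrC.
      by rewrite ge_min mulrC lexx orbT.
    rewrite transferD// => [|y]; last by rewrite mulrC.
    have Ki : 0 <= K^-1 by rewrite invr_ge0 ltW.
    rewrite (transferZ _ Z_ge0 Ki) EFinD leeD//.
      rewrite /transfer (esum_supp_seq uF) => [||y yF].
      - by rewrite sumEFin/= xF.
      - by move=> y; rewrite lee_fin mulr_ge0.
      - by rewrite stay_notin// mulr0.
    rewrite mulrC EFinM lee_pmul2l ?lte_fin ?invr_gt0//.
    exact: Z_super.
exists (\bigcap_n U n); split.
- by apply: bigcapT_measurable.
- apply/eqP; rewrite eq_le measure_ge0 andbT; apply/lee_addgt0Pr => e e0.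
  (* With this level, leaving [Z < K] costs at most [e / 2]. *)
  rewrite add0e; pose K := 2 * (Z x0 + 1) / e.
  have K0 : 0 < K by rewrite divr_gt0// mulr_gt0// ltr_wpDl.
  have [F [uF FG UF]] := Ubound K K0.
  have /cvgrPdist_lt/(_ (e / 2)) := stay_cvg uF FG x0 no_trap.
  rewrite divr_gt0// => /(_ isT)[N _ /(_ N (leqnn N))/=].
  rewrite sub0r normrN ger0_norm; last by case/andP: (stay_bounds uF FG N x0).
  move=> sN; apply: (@le_trans _ _ (P (U N))).
    apply: le_measure; rewrite ?inE//; last by move=> w; exact.
    exact: bigcapT_measurable.
  apply: le_trans (UF N) _; rewrite lee_fin.
  have : Z x0 / K <= e / 2.
    rewrite ler_pdivrMr// (_ : e / 2 * K = Z x0 + 1) ?lerDl//.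
    by rewrite /K; field; rewrite gt_eqF.
  by move: sN; lra.
- by move=> w /= nex n _; apply/negP => Aw; apply: nex; exists n.
Qed.
End Lyapunov.
End Traps.

(** * One toppling of the network *)

Section Network.
Variables (R : realType) (V : finType) (N : network R V).
Local Notation state := (config V * env N)%type.
Implicit Types (x y : state) (v w u : V) (eta : config V).

Lemma measurable_config (A : set (config V)) : measurable A.
Proof. by []. Qed.
Hint Resolve measurable_config : core.

Lemma measurable_fun_config d (T : sigmaRingType d) (D : set (config V))
  (f : config V -> T) : measurable_fun D f.
Proof. by move=> mD B mB; exact: measurable_config. Qed.
Hint Resolve measurable_fun_config : core.

Section law_on_configs.
Variable nu : probability (config V) R.

Lemma law_pos_ae (Q : config V -> Prop) xi :
  {ae nu, forall z, Q z} -> (0 < nu [set xi])%E -> Q xi.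
Proof.
move=> /negligibleP-/(_ (measurable_config _)) Q0 nxi; apply: contrapT => nQ.
suff : (nu [set xi] <= 0)%E by rewrite leNgt nxi.
by rewrite -Q0; apply: le_measure; rewrite ?inE// => _ ->.
Qed.

Lemma law_pos_ex : exists xi, (0 < nu [set xi])%E.
Proof.
apply: contrapT => nex.
have : \esum_(z in [set: config V]) nu [set z] = 0%E.
  apply: esum1 => z _; apply/eqP; rewrite eq_le measure_ge0 andbT leNgt.
  by apply/negP => nz; apply: nex; exists z.
rewrite -measure_fibers//; last by move=> i j _ _ [z [-> ->]].
rewrite (_ : \bigcup_t _ = setT); last first.
  by apply/seteqP; split => // z _; exists z.
move=> n0; have := probability_setT nu; rewrite n0 => /eqP.
by rewrite eq_sym onee_eq0.
Qed.
End law_on_configs.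

Definition topple x v (s : env_state N v) (xi : config V) : state :=
  (x.1 + xi, update_env x.2 s).

Lemma update_env_same (q : env N) v (s : env_state N v) : update_env q s v = s.
Proof. by rewrite /update_env ffunE dfwith_in. Qed.

Lemma update_env_other (q : env N) v (s : env_state N v) w : v != w ->
  update_env q s w = q w.
Proof. by move=> vw; rewrite /update_env ffunE dfwith_out. Qed.

Lemma sum_update_env (q : env N) v (s : env_state N v)
    (phi : forall v, env_state N v -> R) :
  \sum_w phi w (update_env q s w) = \sum_w phi w (q w) + phi v s - phi v (q v).
Proof.
rewrite (bigD1 v)//= [in RHS](bigD1 v)//= update_env_same.
under eq_bigr do rewrite update_env_other 1?eq_sym//.
by ring.
Qed.

Lemma excess_ge0 eta v : 0 <= excess N eta v.
Proof. by rewrite /excess ler0z le_max lexx orbT. Qed.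

Lemma excess_gt0 eta v : (0 < excess N eta v) = ((threshold N v)%:Z < eta v).
Proof. by rewrite /excess ltr0z lt_max ltxx orbF subr_gt0. Qed.

Lemma unstableP eta :
  reflect (exists v, (threshold N v)%:Z < eta v) (~~ stable N eta).
Proof.
rewrite /stable negb_forall; apply: (iffP existsP) => -[v].
  by rewrite -ltNge; exists v.
by rewrite ltNge; exists v.
Qed.

Lemma sum_excess_gt0 eta v : (threshold N v)%:Z < eta v ->
  0 < \sum_u excess N eta u.
Proof.
rewrite -excess_gt0 => ev; rewrite (bigD1 v)//=.
by apply: ltr_pwDl => //; apply: sumr_ge0 => w _; exact: excess_ge0.
Qed.

Lemma choice_prob_ge0 eta v : 0 <= choice_prob N eta v.
Proof. by rewrite divr_ge0 ?excess_ge0// sumr_ge0// => w _; exact: excess_ge0. Qed.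

Lemma choice_prob_gt0 eta v :
  (0 < choice_prob N eta v) = ((threshold N v)%:Z < eta v).
Proof.
apply/idP/idP => [c0|tv]; last first.
  by rewrite divr_gt0 ?excess_gt0// (sum_excess_gt0 tv).
rewrite -excess_gt0 lt_neqAle excess_ge0 andbT.
by apply: contraTneq c0; rewrite /choice_prob => <-; rewrite mul0r ltxx.
Qed.

Lemma sum_choice_prob eta : ~~ stable N eta -> \sum_v choice_prob N eta v = 1.
Proof.
move=> /unstableP[v /sum_excess_gt0 s0].
by rewrite /choice_prob -mulr_suml divff// gt_eqF.
Qed.

Lemma env_trans_ge0 v s s' : 0 <= env_trans N v s s'.
Proof. by have [] := @env_trans_stochastic R V N v. Qed.

Lemma sum_env_trans v s : \sum_s' env_trans N v s s' = 1.
Proof. by have [_ ->] := @env_trans_stochastic R V N v. Qed.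

Definition kern x y : R := fine (trans_prob x.1 x.2 y.1 y.2).

Lemma trans_probE x y : trans_prob x.1 x.2 y.1 y.2 = (kern x y)%:E.
Proof.
rewrite /kern fineK// /trans_prob; case: ifP => // _.
apply/sum_fin_numP => v _ _; apply/sum_fin_numP => s _ _.
by rewrite fin_numM// fin_num_measure.
Qed.

Lemma trans_prob_ge0 x y : (0 <= trans_prob x.1 x.2 y.1 y.2)%E.
Proof.
rewrite /trans_prob; case: ifP => _; first by rewrite lee_fin.
apply: sume_ge0 => v _; apply: sume_ge0 => s _; apply: mule_ge0 => //.
rewrite lee_fin mulr_ge0// mulr_ge0//; first exact: choice_prob_ge0.
exact: env_trans_ge0.
Qed.

Lemma kern_ge0 x y : 0 <= kern x y.
Proof. by rewrite -lee_fin -trans_probE trans_prob_ge0. Qed.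

Lemma kern_stable x y : stable N x.1 -> kern x y = (y == x)%:R.
Proof. by case: x y => [? ?] [? ?]; rewrite /kern /trans_prob => ->. Qed.

Lemma toppleE x y v (s : env_state N v) :
  (((y.2 == update_env x.2 s)%:R : R)%:E *
    topple_law N v s [set xi | y.1 = (x.1 + xi)%R] =
  topple_law N v s [set xi | topple x s xi = y])%E.
Proof.
case: eqVneq => [ys|ys].
  rewrite mul1e; congr (topple_law N v s _); apply/seteqP; split=> xi /=.
    by move=> yx; rewrite /topple -yx -ys -surjective_pairing.
  by move=> <-.
rewrite mul0e (_ : [set xi | topple x s xi = y] = set0) ?measure0//.
by apply/seteqP; split=> xi //= xy; rewrite -xy eqxx in ys.
Qed.

Lemma kernE x y : ~~ stable N x.1 -> (kern x y)%:E =
  (\sum_v \sum_s (choice_prob N x.1 v * env_trans N v (x.2 v) s)%:E *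
     topple_law N v s [set xi | topple x s xi = y])%E.
Proof.
move=> /negPf xs; rewrite -trans_probE /trans_prob xs.
apply: eq_bigr => v _; apply: eq_bigr => s _.
by rewrite EFinM -muleA toppleE.
Qed.

(** The sum over target states disappears: each target collects the displacements
    leading to it, and these fibers partition the space of displacements. *)
Lemma transferE (f : state -> R) x : (forall y, 0 <= f y) ->
  ~~ stable N x.1 -> transfer kern f x =
  (\sum_v \sum_s (choice_prob N x.1 v * env_trans N v (x.2 v) s)%:E *
     \int[topple_law N v s]_xi (f (topple x s xi))%:E)%E.
Proof.
move=> f0 xs; rewrite /transfer.
have c0 v s : 0 <= choice_prob N x.1 v * env_trans N v (x.2 v) s.
  by rewrite mulr_ge0 ?choice_prob_ge0 ?env_trans_ge0.
transitivity (\esum_(y in [set: state]) \sum_v \sum_s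
    (choice_prob N x.1 v * env_trans N v (x.2 v) s)%:E *
     (topple_law N v s [set xi | topple x s xi = y] * (f y)%:E))%E.
  apply: eq_esum => y _; rewrite EFinM kernE// ge0_sume_distrl; last first.
    by move=> v _; apply: sume_ge0 => s _; rewrite mule_ge0// lee_fin.
  apply: eq_bigr => v _; rewrite ge0_sume_distrl; last first.
    by move=> s _; rewrite mule_ge0// lee_fin.
  by apply: eq_bigr => s _; rewrite muleA.
rewrite esum_sum; last first.
  move=> y v _ _; apply: sume_ge0 => s _.
  by rewrite !mule_ge0// lee_fin.
apply: eq_bigr => v _; rewrite esum_sum; last first.
  by move=> y s _ _; rewrite !mule_ge0// lee_fin.
apply: eq_bigr => s _; rewrite esumZl//; last first.
  by move=> y; rewrite !mule_ge0// lee_fin.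
congr (_ * _)%E; rewrite (@ge0_integral_fibers _ _ _ _ state
  (fun y => [set xi | topple x s xi = y]))//.
- apply: eq_esum => y _.
  rewrite (eq_integral (fun=> (f y)%:E)) => [|xi]; last by rewrite inE => /= ->.
  by rewrite integral_cst// muleC.
- by move=> y z _ _ [xi [/= -> ->]].
- by apply/seteqP; split=> // xi _; exists (topple x s xi).
- by move=> xi; rewrite lee_fin.
Qed.

Lemma kern_topple_gt0 x v (s : env_state N v) xi :
  (threshold N v)%:Z < x.1 v -> 0 < env_trans N v (x.2 v) s ->
  (0 < topple_law N v s [set xi])%E -> 0 < kern x (topple x s xi).
Proof.
move=> tv Ps nxi; rewrite -lte_fin kernE; last by apply/unstableP; exists v.
have t0 w (s' : env_state N w) : (0 <= (choice_prob N x.1 w *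
     env_trans N w (x.2 w) s')%:E * topple_law N w s'
       [set xi' | topple x s' xi' = topple x s xi])%E.
  by rewrite mule_ge0// lee_fin mulr_ge0 ?choice_prob_ge0 ?env_trans_ge0.
rewrite (bigD1 v)//=; apply: (lt_le_trans _ (leeDl _ _)); last first.
  by apply: sume_ge0 => w _; apply: sume_ge0.
rewrite (bigD1 s)//=; apply: (lt_le_trans _ (leeDl _ _)); last exact: sume_ge0.
rewrite mule_gt0//.
  by rewrite lte_fin; apply: mulr_gt0 => //; rewrite choice_prob_gt0.
by apply: lt_le_trans nxi _; apply: le_measure; rewrite ?inE// => _ ->.
Qed.

Lemma kern_gt0_inv x y : ~~ stable N x.1 -> 0 < kern x y ->
  exists v (s : env_state N v) xi, [/\ (threshold N v)%:Z < x.1 v,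
    0 < env_trans N v (x.2 v) s, (0 < topple_law N v s [set xi])%E &
    y = topple x s xi].
Proof.
move=> xs; rewrite -lte_fin kernE// => k0; apply: contrapT => nex.
move: k0; rewrite big1 ?ltxx// => v _; rewrite big1// => s _.
have [tv|tv] := boolP ((threshold N v)%:Z < x.1 v); last first.
  rewrite (_ : choice_prob N x.1 v = 0) ?mul0r ?mul0e//.
  by apply/eqP; rewrite eq_le choice_prob_ge0 andbT leNgt choice_prob_gt0.
have := env_trans_ge0 (x.2 v) s; rewrite le_eqVlt => /orP[/eqP<-|Ps].
  by rewrite mulr0 mul0e.
rewrite (_ : topple_law N v s _ = 0%E) ?mule0//.
apply/eqP; rewrite eq_le measure_ge0 andbT leNgt; apply/negP => nxi.
apply: nex; exists v, s, (y.1 - x.1).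
have xy xi : topple x s xi = y -> xi = y.1 - x.1.
  by move=> <-; rewrite /topple /= addrC addKr.
have tE : topple x s (y.1 - x.1) = y.
  apply: contrapT => ny; move: nxi; rewrite (_ : mkset _ = set0) ?measure0 ?ltxx//.
  by apply/seteqP; split=> xi //= xiy; apply: ny; rewrite -(xy _ xiy).
split => //; apply: lt_le_trans nxi _.
by apply: le_measure; rewrite ?inE// => xi /= /xy.
Qed.
End Network.

(** * The charge and its drift *)

Section Charge.
Variables (R : realType) (V : finType) (N : network R V).
Local Notation state := (config V * env N)%type.
Implicit Types (x y : state) (v w u : V) (eta : config V).

#[local] Hint Extern 0 (measurable _) => exact: measurable_config : core.
#[local] Hint Extern 0 (measurable_fun _ _) => exact: measurable_fun_config : core.

Lemma law_ae (nu : probability (config V) R) (Q : config V -> Prop) :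
  (forall xi, (0 < nu [set xi])%E -> Q xi) -> {ae nu, forall xi, Q xi}.
Proof.
move=> Qpos; apply/negligibleP => //.
have -> : ~` [set xi | Q xi] =
    \bigcup_t ([set t] `&` ~` [set xi : config V | Q xi]).
  by apply/seteqP; split=> z; [move=> nQ; exists z|move=> [t _ [/= ->]]].
apply: (etrans (measure_fibers nu _ _)) => //.
  by move=> i j _ _ [z [[/= -> _] [/= -> _]]].
rewrite esum1// => z _; apply/eqP; rewrite eq_le measure_ge0 andbT leNgt.
  apply/negP => nz; have Qz : Q z.
    by apply: Qpos; apply: lt_le_trans nz _; apply: le_measure; rewrite ?inE// => t [].
  move: nz; rewrite (_ : _ `&` _ = set0) ?measure0 ?ltxx//.
  by apply/seteqP; split=> t //= -[->].
Qed.

Lemma integral_law_cst (nu : probability (config V) R) (k : R) :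
  (\int[nu]_xi k%:E = k%:E)%E.
Proof.
rewrite integral_cst// [X in (_ * X)%E](_ : _ = 1%E) ?mule1//.
exact: probability_setT.
Qed.

Lemma mean_toppleE v (s : env_state N v) w :
  (\int[topple_law N v s]_xi ((xi w)%:~R : R)%:E = (mean_topple s w)%:E)%E.
Proof.
rewrite /mean_topple unlock fineK//.
exact: integrable_fin_num (topple_law_integrable s w).
Qed.

Lemma integrable_affine v (s : env_state N v) (b : V -> R) k :
  (topple_law N v s).-integrable setT
    (fun xi => (k + \sum_w b w * (xi w)%:~R)%:E) /\
  (\int[topple_law N v s]_xi (k + \sum_w b w * (xi w)%:~R)%:E =
    (k + \sum_w b w * mean_topple s w)%:E)%E.
Proof.
elim: (index_enum V) => [|u r [IH1 IH2]].
  rewrite (_ : (fun xi => _) = EFin \o cst k); last first.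
    by apply/funext => xi /=; rewrite big_nil addr0.
  split; first exact: finite_measure_integrable_cst.
  rewrite big_nil addr0 -[RHS](integral_law_cst (topple_law N v s)).
  by [].
have eqf : (fun xi : config V => (k + \sum_(w <- u :: r) b w * (xi w)%:~R)%:E) =
    ((fun xi : config V => (b u)%:E * ((xi u)%:~R)%:E) \+
    (fun xi : config V => (k + \sum_(w <- r) b w * (xi w)%:~R)%:E))%E.
  by apply/funext => xi /=; rewrite big_cons -EFinM -EFinD addrCA.
have int1 := integrableZl measurableT (b u) (topple_law_integrable s u).
rewrite eqf; split; first exact: integrableD.
rewrite [LHS]integralD// IH2 integralZl//; last exact: topple_law_integrable.
by rewrite mean_toppleE big_cons -EFinM -EFinD addrCA.
Qed.

Definition nonneg x := forall v, 0 <= x.1 v.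

Variables (a : V -> R) (phi : forall v, env_state N v -> R).

Definition charge x : R := charge_at a phi x.1 x.2.

Lemma charge_topple x v (s : env_state N v) xi : charge (topple x s xi) =
  (charge x + phi s - phi (x.2 v)) + \sum_w a w * (xi w)%:~R.
Proof.
rewrite /charge /charge_at !big_split/= sum_update_env.
under eq_bigr do rewrite ffunE rmorphD mulrDr.
by rewrite big_split/=; ring.
Qed.
Section assumptions.
Hypothesis xi_offdiag_ge0 : forall (v : V) (s : env_state N v) (w : V), w != v ->
  {ae topple_law N v s, forall xi : config V, 0 <= xi w}.
Hypothesis xi_diag_ge : forall (v : V) (s : env_state N v),
  {ae topple_law N v s, forall xi : config V, - xi v <= (threshold N v)%:Z}.

(** A vertex topples only above its threshold, and then loses at most the
    threshold. *)
Lemma topple_nonneg x v (s : env_state N v) xi : nonneg x ->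
  (threshold N v)%:Z < x.1 v -> (0 < topple_law N v s [set xi])%E ->
  nonneg (topple x s xi).
Proof.
move=> x0 tv xipos w; rewrite /= ffunE.
have [->|wv] := eqVneq w v.
  rewrite -lerBlDr sub0r; apply: le_trans (ltW tv).
  exact: (law_pos_ae (xi_diag_ge s)).
by apply: addr_ge0 => //; exact: (law_pos_ae (xi_offdiag_ge0 s wv)).
Qed.

Lemma nonneg_closed x y : nonneg x -> 0 < kern x y -> nonneg y.
Proof.
move=> x0; have [xs|xs] := boolP (stable N x.1).
  by rewrite kern_stable//; case: eqP => [->//|_]; rewrite ltxx.
by move=> /(kern_gt0_inv xs)[v [s [xi [tv _ xipos ->]]]]; exact: topple_nonneg.
Qed.

Lemma transfer_avg (f : state -> R) x (h : forall v, env_state N v -> R) :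
  (forall y, 0 <= f y) -> ~~ stable N x.1 ->
  (forall v (s : env_state N v), (threshold N v)%:Z < x.1 v ->
    (\int[topple_law N v s]_xi (f (topple x s xi))%:E = (h v s)%:E)%E) ->
  transfer (@kern R V N) f x = (\sum_v choice_prob N x.1 v *
    \sum_s env_trans N v (x.2 v) s * h v s)%:E.
Proof.
move=> f0 xs hE; rewrite transferE// -sumEFin; apply: eq_bigr => v _.
rewrite mulr_sumr -sumEFin; apply: eq_bigr => s _.
have [tv|] := boolP ((threshold N v)%:Z < x.1 v).
  by rewrite hE// -EFinM mulrA.
rewrite -(@choice_prob_gt0 R) lt_neqAle choice_prob_ge0 andbT negbK => /eqP <-.
by rewrite !mul0r mul0e.
Qed.

Lemma transfer1 x : transfer (@kern R V N) (fun=> 1) x = 1%:E.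
Proof.
have [xs|xs] := boolP (stable N x.1).
  rewrite /transfer (@esum_supp_seq _ _ [:: x])// => [|y|y].
  - by rewrite big_seq1 kern_stable// eqxx mulr1.
  - by rewrite lee_fin mulr1 kern_ge0.
  - by rewrite inE => /negPf yx; rewrite kern_stable// yx mul0r.
rewrite (@transfer_avg _ _ (fun _ _ => 1))// => [|v s _].
  under eq_bigr => v _.
    under eq_bigr do rewrite mulr1.
    by rewrite sum_env_trans mulr1; over.
  by rewrite sum_choice_prob.
exact: integral_law_cst.
Qed.

(** The condition on [phi] under which toppling [v] changes the charge by
    [rho * a v] on average from each environment state, and not only under the
    stationary law. *)
Definition corrector rho := forall v s, \sum_s' env_trans N v s s' *
  (\sum_w a w * mean_topple s' w + phi s') - phi s = rho * a v.

Lemma exists_lb_charge : (forall v, 0 < a v) ->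
  exists c, forall x, nonneg x ->
    \sum_v a v * (x.1 v)%:~R <= charge x + c.
Proof.
move=> a0; pose B v := \sum_(s : env_state N v) `|phi s|.
exists (\sum_v B v) => x x0; rewrite /charge /charge_at -big_split/=; apply: ler_sum => v _.
rewrite -addrA lerDl -lerBlDr sub0r.
have : `|phi (x.2 v)| <= B v.
  by rewrite /B (bigD1 (x.2 v))//= lerDl sumr_ge0.
by move=> h; rewrite lerNl (le_trans _ h)// -normrN ler_norm.
Qed.

Section potential.
Variables (rho c : R).
Hypothesis a_gt0 : forall v, 0 < a v.
Hypothesis phiP : corrector rho.
Hypothesis charge_lb : forall x, nonneg x ->
  \sum_v a v * (x.1 v)%:~R <= charge x + c.

Lemma charge_ge0 x : nonneg x -> 0 <= charge x + c.
Proof.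
move=> x0; apply: le_trans (charge_lb x0); apply: sumr_ge0 => v _.
by apply: mulr_ge0; [exact: ltW|rewrite ler0z].
Qed.

(** Truncated at zero so as to be nonnegative also off the nonnegative states,
    which the dynamics never visits. *)
Definition potential x : R := Num.max 0 (charge x + c).

Lemma potential_ge0 x : 0 <= potential x.
Proof. by rewrite le_max lexx. Qed.

Lemma potentialE x : nonneg x -> potential x = charge x + c.
Proof. by move=> /charge_ge0 x0; exact/max_idPr. Qed.

Lemma transfer_potential x : nonneg x -> ~~ stable N x.1 ->
  transfer (@kern R V N) potential x =
  (potential x + rho * \sum_v choice_prob N x.1 v * a v)%:E.
Proof.
move=> x0 xs.
rewrite (@transfer_avg _ _ (fun v s => potential x + (phi s - phi (x.2 v))
    + \sum_w a w * mean_topple s w))//; last 2 first.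
- exact: potential_ge0.
- move=> v s tv; rewrite -(integrable_affine s a _).2.
  apply: ae_eq_integral => //; apply: law_ae => xi xipos _.
  rewrite !potentialE//; last exact: topple_nonneg.
  by rewrite charge_topple; congr EFin; ring.
congr EFin.
have avg v : \sum_s env_trans N v (x.2 v) s *
    (potential x + (phi s - phi (x.2 v)) + \sum_w a w * mean_topple s w) =
    potential x + rho * a v.
  rewrite -(phiP (x.2 v)).
  transitivity (\sum_s env_trans N v (x.2 v) s * (potential x - phi (x.2 v)) +
    \sum_s env_trans N v (x.2 v) s *
      (\sum_w a w * mean_topple s w + phi s)).
    by rewrite -big_split/=; apply: eq_bigr => s _; ring.
  by rewrite -mulr_suml sum_env_trans; ring.
under eq_bigr do rewrite avg mulrDr.
rewrite big_split/= -mulr_suml sum_choice_prob// mul1r mulr_sumr.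
by congr (_ + _); apply: eq_bigr => v _; rewrite mulrCA.
Qed.
End potential.
End assumptions.
End Charge.

(** * Trajectories of the network *)

Section Realization.
Variables (R : realType) (V : finType) (N : network R V).
Local Notation state := (config V * env N)%type.
Variables (eta0 : V -> nat) (q0 : env N) (X : realization eta0 q0).

Definition trajectory n (w : sample X) : state := (eta_ X n w, q_ X n w).
Definition initial_state : state := (config_of_nat eta0, q0).

Lemma trajectory_set n (x : state) :
  [set w | trajectory n w = x] =
  [set w | eta_ X n w = x.1] `&` [set w | q_ X n w = x.2].
Proof. by apply/seteqP; split=> w; case: x => a b /=; [case|case=> <- <-]. Qed.

Lemma trajectory_measurable n (x : state) :
  measurable [set w | trajectory n w = x].
Proof.
rewrite trajectory_set; apply: measurableI.
  exact: eta_measurable.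
exact: q_measurable.
Qed.

Lemma trajectory_markov n (x : nat -> state) :
  (law X [set w | forall i, (i <= n.+1)%N -> trajectory i w = x i] =
  law X [set w | forall i, (i <= n)%N -> trajectory i w = x i] *
  (kern (x n) (x n.+1))%:E)%E.
Proof.
have E m : [set w | forall i, (i <= m)%N -> trajectory i w = x i] =
    [set w | forall i, (i <= m)%N -> eta_ X i w = (x i).1 /\ q_ X i w = (x i).2].
  apply/seteqP; split=> w /= h i /h; rewrite /trajectory.
    by move=> <-.
  by case=> -> ->; rewrite -surjective_pairing.
by rewrite !E Defs.markov trans_probE.
Qed.

Lemma trajectory0 : {ae law X, forall w, trajectory 0 w = initial_state}.
Proof.
apply: negligibleS (init X) => w /= h1 [h2 h3]; apply: h1.
by rewrite /trajectory h2 h3.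
Qed.

Lemma initial_nonneg : nonneg initial_state.
Proof. by move=> v; rewrite ffunE. Qed.

End Realization.

(** * Correcting the charge for the environment *)

Section Corrector.
Variables (R : realType) (V : finType) (N : network R V).
Local Notation state := (config V * env N)%type.

Lemma topple_mxE v w : entry (topple_mx N) v w =
  \sum_s env_stat N v s * mean_topple s w.
Proof. by rewrite /entry mxE !enum_rankK. Qed.

(** For each vertex this is a Poisson equation for its environment; it is
    solvable because [rho * a v] is the stationary mean of the change of charge. *)
Lemma exists_corrector (a : V -> R) rho :
  (forall v, \sum_w entry (topple_mx N) v w * a w = rho * a v) ->
  exists phi : forall v, env_state N v -> R, corrector a phi rho.
Proof.
move=> Ma.
have sol v : exists f : env_state N v -> R, forall s,
    f s - \sum_s' env_trans N v s s' * f s' =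
    \sum_s' env_trans N v s s' * (\sum_w a w * mean_topple s' w) - rho * a v.
  apply: (Poisson_equation (@env_trans_stochastic R V N v)
    (@env_trans_irreducible R V N v) (@env_stat_stationary R V N v)).
  have [_ pi1 piP] := env_stat_stationary N v.
  under eq_bigr do rewrite mulrBr.
  rewrite sumrB -mulr_suml pi1 mul1r; apply/eqP; rewrite subr_eq0; apply/eqP.
  under eq_bigr do rewrite mulr_sumr.
  rewrite exchange_big/= -Ma.
  under [RHS]eq_bigr do rewrite topple_mxE mulr_suml.
  rewrite [RHS]exchange_big/=; apply: eq_bigr => s _.
  under eq_bigr do rewrite mulrA.
  rewrite -mulr_suml piP mulr_sumr; apply: eq_bigr => w _.
  by rewrite -mulrA [a w * _]mulrC.
have [phi phiP] : exists phi : forall v, env_state N v -> R, forall v s,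
    \sum_s' env_trans N v s s' * (\sum_w a w * mean_topple s' w) - rho * a v =
    phi v s - \sum_s' env_trans N v s s' * phi v s'.
  exists (fun v => sval (cid (sol v))) => v s.
  by rewrite (svalP (cid (sol v)) s).
exists phi => v s; under eq_bigr do rewrite mulrDr.
have /eqP := phiP v s; rewrite subr_eq => /eqP Pg.
by rewrite big_split/= Pg; ring.
Qed.
End Corrector.

(** * The charge as a Lyapunov function *)

Section Proper.
Variables (R : realType) (V : finType) (N : network R V).
Local Notation state := (config V * env N)%type.

Lemma bounded_states_finite (B : nat) : exists s : seq state,
  forall x : state, (forall v, 0 <= x.1 v < B%:Z) -> x \in s.
Proof.
exists (codom (fun p : ({ffun V -> 'I_B.+1} * env N)%type =>
  ([ffun v => (p.1 v : nat)%:Z] : config V, p.2) : state)) => -[eta q] /= xB.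
apply/codomP; exists ([ffun v => inord `|eta v|%N], q).
congr pair; apply/ffunP => v; rewrite !ffunE inordK.
  by case/andP: (xB v) => /gez0_abs.
by case/andP: (xB v) => v0 vB; rewrite ltnS -lez_nat gez0_abs// ltW.
Qed.

Variables (a : V -> R) (phi : forall v, env_state N v -> R) (c : R).
Hypothesis a_gt0 : forall v, 0 < a v.
Hypothesis charge_lb : forall x : state, nonneg x ->
  \sum_v a v * (x.1 v)%:~R <= charge a phi x + c.

Lemma potential_proper K : exists s : seq state,
  forall x, nonneg x -> potential a phi c x < K -> x \in s.
Proof.
pose B := (\max_v Num.bound (`|K| / a v))%N.
have [s sP] := bounded_states_finite B.
exists s => x x0 xK; apply: sP => v; rewrite x0/=.
have avK : a v * (x.1 v)%:~R <= `|K|.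
  apply: le_trans (ler_norm K); apply: le_trans (ltW xK).
  rewrite /potential le_max; apply/orP; right; apply: le_trans (charge_lb x0).
  rewrite (bigD1 v)//= lerDl; apply: sumr_ge0 => w _.
  by apply: mulr_ge0; [exact: ltW|rewrite ler0z].
rewrite -(ltr_int R); apply: (@le_lt_trans _ _ (`|K| / a v)).
  by rewrite ler_pdivlMr// mulrC.
apply: (@lt_le_trans _ _ (Num.bound (`|K| / a v))%:R).
  by apply: archi_boundP; rewrite divr_ge0// ltW.
by rewrite ler_nat /B (bigD1 v)//= leq_maxl.
Qed.
End Proper.

Section Stabilization.
Variables (R : realType) (V : finType) (N : network R V).
Local Notation state := (config V * env N)%type.
Hypothesis xi_offdiag_ge0 : forall (v : V) (s : env_state N v) (w : V), w != v ->
  {ae topple_law N v s, forall xi : config V, 0 <= xi w}.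
Hypothesis xi_diag_ge : forall (v : V) (s : env_state N v),
  {ae topple_law N v s, forall xi : config V, - xi v <= (threshold N v)%:Z}.
Variables (a : V -> R) (phi : forall v, env_state N v -> R) (rho : R).
Hypothesis a_gt0 : forall v, 0 < a v.
Hypothesis phiP : corrector a phi rho.

Definition net_trap := trap (@kern R V N) (@nonneg R V N)
  (fun x : state => stable N x.1).

Lemma mean_weight_gt0 (x : state) : ~~ stable N x.1 ->
  0 < \sum_v choice_prob N x.1 v * a v.
Proof.
move=> /unstableP[v tv]; rewrite (bigD1 v)//=; apply: ltr_pwDl.
  by rewrite mulr_gt0// choice_prob_gt0.
by apply: sumr_ge0 => w _; rewrite mulr_ge0 ?choice_prob_ge0// ltW.
Qed.

(** On a trap the minimum principle applies to the potential.  At a minimiser the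
    potential has no drift, which excludes [rho < 0]. *)
Lemma trap_constant_charge D : rho <= 0 -> net_trap D ->
  rho = 0 /\ exists m, net_trap (fun x => D x /\ charge a phi x = m).
Proof.
move=> rho0 tD; have [_ _ DG0 _] := tD; have [c c_lb] := exists_lb_charge phi a_gt0.
have drift := transfer_potential xi_offdiag_ge0 xi_diag_ge a_gt0 phiP c_lb.
have [m [tDm Dm]] : exists m, net_trap (fun x => D x /\ potential a phi c x = m) /\
    forall x, D x -> potential a phi c x = m ->
      transfer (@kern R V N) (potential a phi c) x = (potential a phi c x)%:E.
  apply: trap_argmin tD _ _ => [x y|x _|x|x Dx].
  - exact: kern_ge0.
  - exact: transfer1.
  - exact: potential_ge0.
  - have [x0 xs] := DG0 x Dx.
    rewrite drift// lee_fin gerDl; apply: mulr_le0_ge0 => //.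
    exact: ltW (mean_weight_gt0 xs).
have [[x [Dx xm]] _ DG _] := tDm.
split.
  have [x0 xs] := DG x (conj Dx xm).
  have := Dm x Dx xm; rewrite drift// => -[] /eqP.
  rewrite -[X in _ == X]addr0 (inj_eq (addrI _)) mulf_eq0.
  by rewrite [X in _ || X]gt_eqF ?mean_weight_gt0// orbF => /eqP.
exists (m - c); rewrite (_ : (fun x => _) =
  (fun x => D x /\ potential a phi c x = m))//.
apply/funext => y; apply/propext; split=> -[Dy].
  by move=> cy; split=> //; rewrite (potentialE a_gt0 c_lb (DG0 y Dy).1) cy subrK.
by rewrite (potentialE a_gt0 c_lb (DG0 y Dy).1) => <-; rewrite addrK.
Qed.

Lemma no_trap_stabilizes (eta0 : V -> nat) (q0 : env N)
    (X : realization eta0 q0) :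
  rho <= 0 -> (forall D, ~ net_trap D) -> stabilizes_as X.
Proof.
move=> rho0 notrap; have [c c_lb] := exists_lb_charge phi a_gt0.
have drift := transfer_potential xi_offdiag_ge0 xi_diag_ge a_gt0 phiP c_lb.
apply: (Lyapunov_absorbed (@kern_ge0 R V N) (fun x _ => transfer1 x)
  (potential_ge0 a phi c) _ _ _ notrap (@trajectory_measurable R V N eta0 q0 X)
  (@trajectory_markov R V N eta0 q0 X) (trajectory0 X)
  (initial_nonneg eta0 q0) (nonneg_closed xi_offdiag_ge0 xi_diag_ge)).
- move=> x x0 xs; rewrite drift// lee_fin gerDl; apply: mulr_le0_ge0 => //.
  exact: ltW (mean_weight_gt0 xs).
- move=> K; have [s sP] := potential_proper a_gt0 c_lb K.
  by exists s => x x0 _; exact: sP.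
- by move=> x y xs; rewrite kern_stable//; case: eqP => // _; rewrite ltxx.
Qed.
End Stabilization.

(** * Topplings inside a minimal trap *)

Section TrapTopplings.
Variables (R : realType) (V : finType) (N : network R V).
Local Notation state := (config V * env N)%type.
Hypothesis xi_offdiag_ge0 : forall (v : V) (s : env_state N v) (w : V), w != v ->
  {ae topple_law N v s, forall xi : config V, 0 <= xi w}.
Hypothesis xi_diag_ge : forall (v : V) (s : env_state N v),
  {ae topple_law N v s, forall xi : config V, - xi v <= (threshold N v)%:Z}.

Lemma mean_topple_ge0 v (s : env_state N v) w : w != v -> 0 <= mean_topple s w.
Proof.
move=> wv; rewrite -lee_fin -mean_toppleE.
rewrite (ae_eq_integral (fun xi : config V => (Num.max 0 (xi w)%:~R : R)%:E)).
- by apply: integral_ge0 => xi _; rewrite lee_fin le_max lexx.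
- exact: measurable_config.
- exact: measurable_fun_config.
- exact: measurable_fun_config.
- apply: filterS (xi_offdiag_ge0 s wv) => xi xi0 _.
  by congr EFin; apply/esym/max_idPr; rewrite ler0z.
Qed.

Lemma mean_topple_gt0_ex v (s : env_state N v) w : w != v ->
  0 < mean_topple s w ->
  exists2 xi, (0 < topple_law N v s [set xi])%E & 0 < xi w.
Proof.
move=> wv m0; apply: contrapT => nex; move: m0.
suff : mean_topple s w = 0 by move=> ->; rewrite ltxx.
suff : (mean_topple s w)%:E = 0%:E by case.
rewrite -mean_toppleE -(integral_law_cst (topple_law N v s) 0).
apply: ae_eq_integral.
- exact: measurable_config.
- exact: measurable_fun_config.
- exact: measurable_fun_config.
- apply: law_ae => xi xipos _; congr EFin.
  suff -> : xi w = 0 by [].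
  apply/eqP; rewrite eq_le (law_pos_ae (xi_offdiag_ge0 s wv) xipos) andbT leNgt.
  by apply/negP => xiw; apply: nex; exists xi.
Qed.

Lemma topple_mx_offdiag_ge0 v w : v != w -> 0 <= entry (topple_mx N) v w.
Proof.
move=> vw; rewrite topple_mxE; apply: sumr_ge0 => s _.
have [pi0 _ _] := env_stat_stationary N v.
by rewrite mulr_ge0// mean_topple_ge0// eq_sym.
Qed.

Hypothesis M_irr : exists2 k : nat, (1 <= k)%N & forall v w : V, v != w ->
  0 < entry ((topple_mx N - diag_part (topple_mx N)) ^+ k) v w.

Section minimal.
Variable C : state -> Prop.
Hypothesis trapC : net_trap C.
Hypothesis minC : forall C', net_trap C' -> (forall x, C' x -> C x) ->
  forall x, C x -> C' x.

Definition topplable v (s : env_state N v) :=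
  exists x, [/\ C x, (threshold N v)%:Z < x.1 v & x.2 v = s].

Lemma trap_topple x v (s : env_state N v) xi : C x ->
  (threshold N v)%:Z < x.1 v -> 0 < env_trans N v (x.2 v) s ->
  (0 < topple_law N v s [set xi])%E -> C (topple x s xi).
Proof.
have [_ _ _ Ccl] := trapC => Cx tv Ps xipos.
exact: Ccl Cx (kern_topple_gt0 tv Ps xipos).
Qed.

(** The states with the property form a trap inside a minimal one. *)
Lemma minimal_closed (Q : state -> Prop) x0 : C x0 -> Q x0 ->
  (forall x v (s : env_state N v) xi, C x -> Q x ->
    (threshold N v)%:Z < x.1 v -> (0 < topple_law N v s [set xi])%E ->
    Q (topple x s xi)) ->
  forall x, C x -> Q x.
Proof.
move=> Cx0 Qx0 Qcl x Cx; have [_ [l Cl] CG Ccl] := trapC.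
suff : C x /\ Q x by case.
apply: (minC (C' := fun x => C x /\ Q x)) Cx; last by move=> y [].
split.
- by exists x0.
- by exists l => y [/Cl].
- by move=> y [/CG].
- move=> y z [Cy Qy] kyz; split; first exact: Ccl kyz.
  have [_ ys] := CG _ Cy.
  have [v [s [xi [tv _ xipos ->]]]] := kern_gt0_inv ys kyz.
  exact: Qcl.
Qed.

(** If no toppling of [v] started from [s'], the environment of [v] would be
    frozen at [s'] once it has reached it. *)
Lemma topplable_trans v (s s' : env_state N v) : topplable s ->
  0 < env_trans N v s s' -> topplable s'.
Proof.
move=> [x [Cx tv xs]] Pss'; have [xi xipos] := law_pos_ex (topple_law N v s').
apply: contrapT => nt.
have Cy : C (topple x s' xi) by apply: trap_topple => //; rewrite xs.
have : x.2 v = s'.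
  apply: (minimal_closed (Q := fun z => z.2 v = s') Cy) Cx.
    exact: update_env_same.
  move=> z u s1 xi1 Cz zs' tu _ /=.
  have uv : u != v.
    apply/eqP => uv; subst u; apply: nt; exists z; split=> //.
  by rewrite update_env_other.
by move=> xs'; apply: nt; exists x.
Qed.

(** A vertex that never topples inside the trap but can receive particles would
    accumulate them, which is impossible in a minimal trap; irreducibility of [M]
    then spreads the topplings to all vertices. *)
Lemma all_topplable v (s : env_state N v) : topplable s.
Proof.
have irr u (s0 : env_state N u) : topplable s0 -> forall s1, @topplable u s1.
  move=> ts0; apply: (irreducible_closed (@env_trans_stochastic R V N u)
    (@env_trans_irreducible R V N u) ts0) => s1 s2; exact: topplable_trans.
pose U u := `[< exists s0, @topplable u s0 >].
suff Uall u : U u by have /asboolP[s0 /irr] := Uall v; apply.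
have [[x Cx] _ CG _] := trapC; have [_ /unstableP[u0 tu0]] := CG x Cx.
have Uu0 : U u0 by apply/asboolP; exists (x.2 u0), x.
apply: contrapT => /negP nUu.
have [v1 [w1 [/asboolP[s0 ts0] /asboolP nUw M_vw]]] :=
  irreducible_cut topple_mx_offdiag_ge0 M_irr Uu0 nUu.
have w1v1 : w1 != v1.
  by apply/eqP => wv; apply: nUw; rewrite wv; exists s0.
have [pi0 _ piP] := env_stat_stationary N v1.
have [s1 pm] : exists s1, 0 < env_stat N v1 s1 * mean_topple s1 w1.
  apply: contrapT => nex; move: M_vw; rewrite topple_mxE ltNge => /negP; apply.
  apply: sumr_le0 => s1 _; rewrite leNgt; apply/negP => ?; apply: nex.
  by exists s1.
have m0 := mean_topple_ge0 s1 w1v1.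
have ps1 : 0 < env_stat N v1 s1.
  rewrite lt0r pi0 andbT; apply: contraTneq pm => ->.
  by rewrite mul0r ltxx.
have ms1 : 0 < mean_topple s1 w1 by rewrite -(pmulr_rgt0 _ ps1).
have [s2 Ps2] : exists s2, 0 < env_trans N v1 s2 s1.
  apply: contrapT => nex; move: ps1; rewrite -piP ltNge => /negP; apply.
  apply: sumr_le0 => s2 _; rewrite leNgt; apply/negP => pp; apply: nex.
  exists s2; rewrite lt0r env_trans_ge0 andbT; apply: contraTneq pp => ->.
  by rewrite mulr0 ltxx.
have [y [Cy tv ys]] := irr _ _ ts0 s2.
have [xi xipos xiw] := mean_topple_gt0_ex w1v1 ms1.
have Cz : C (topple y s1 xi) by apply: trap_topple => //; rewrite ys.
have : (topple y s1 xi).1 w1 <= y.1 w1.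
  apply: (minimal_closed (Q := fun z => (topple y s1 xi).1 w1 <= z.1 w1) Cz) Cy.
    exact: lexx.
  move=> z u1 s3 xi3 Cz' zw tu1 xi3pos.
  have uw : w1 != u1.
    by apply/eqP => wu; apply: nUw; subst u1; exists (z.2 w1), z.
  apply: le_trans zw _; rewrite [leRHS]ffunE lerDl.
  exact: (law_pos_ae (xi_offdiag_ge0 s3 uw)).
by rewrite /= ffunE gerDl leNgt xiw.
Qed.
End minimal.

(** Every toppling that the network can perform happens inside the minimal trap,
    where the charge is constant. *)
Lemma trap_increments (a : V -> R) (phi : forall v, env_state N v -> R) D m :
  net_trap (fun x => D x /\ charge a phi x = m) ->
  forall v (s s' : env_state N v) xi, 0 < env_trans N v s s' ->
    (0 < topple_law N v s' [set xi])%E ->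
    phi v s' - phi v s + \sum_w a w * (xi w)%:~R = 0.
Proof.
move=> tD v s s' xi Pss' xipos.
have [C tC [CD Cmin]] := trap_minimal tD.
have [x [Cx tv xs]] := all_topplable tC Cmin s.
have Cy : C (topple x s' xi) by apply: trap_topple => //; rewrite xs.
have [_ cx] := CD _ Cx; have [_] := CD _ Cy.
rewrite charge_topple cx xs -addrA -[X in _ = X]addr0 -!addrA => /addrI.
by rewrite addrA.
Qed.
End TrapTopplings.

(** * Conserved quantities *)

Section ConservedQuantities.
Variables (R : realType) (V : finType) (N : network R V).
Local Notation state := (config V * env N)%type.
Variable X : forall (eta0 : V -> nat) (q0 : env N), realization eta0 q0.
Variables (a : V -> R) (phi : forall v, env_state N v -> R).

Definition null_increments := forall v (s s' : env_state N v) xi,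
  0 < env_trans N v s s' -> (0 < topple_law N v s' [set xi])%E ->
  phi s' - phi s + \sum_w a w * (xi w)%:~R = 0.

Lemma null_increments_charge : null_increments -> forall x y : state,
  0 < kern x y -> charge a phi y = charge a phi x.
Proof.
move=> null x y; have [xs|xs] := boolP (stable N x.1).
  by rewrite kern_stable//; case: eqP => [->//|_]; rewrite ltxx.
move=> /(kern_gt0_inv xs)[v [s [xi [_ Ps xipos ->]]]].
rewrite charge_topple; have := null v _ s xi Ps xipos.
by set S := \sum_w _ => h; rewrite -[RHS]addr0 -h; ring.
Qed.

Lemma null_increments_conserved : (exists v, a v != 0) -> null_increments ->
  conserved_quantity X a phi.
Proof.
move=> an0 null; split=> // eta0 q0.
have tr := ae_transition (@kern_ge0 R V N)
  (@trajectory_measurable R V N eta0 q0 (X eta0 q0))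
  (@trajectory_markov R V N eta0 q0 (X eta0 q0))
  (null_increments_charge null).
apply: filterS tr => w step n.
rewrite -![charge_at _ _ _ _]/(charge a phi (trajectory _ w)).
by elim: n => [//|n IH]; rewrite -IH; exact: step.
Qed.

Lemma env_inhabited : inhabited (env N).
Proof.
by split; exact: (finfun (fun v => enum_val (Ordinal (@env_state_gt0 R V N v)))).
Qed.

(** Started where every vertex exceeds its threshold, any toppling is the first
    one with positive probability. *)
Lemma conserved_null_increments : conserved_quantity X a phi -> null_increments.
Proof.
move=> [_ cons] v s s' xi Pss' xipos; have [q] := env_inhabited.
pose eta0 v := (threshold N v).+1; pose q0 := update_env q s.
pose x0 := initial_state eta0 q0.
have qs : x0.2 v = s by exact: update_env_same.
have tv : (threshold N v)%:Z < x0.1 v by rewrite ffunE ltz_nat.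
have k0 : 0 < kern x0 (topple x0 s' xi).
  by apply: kern_topple_gt0 => //; rewrite qs.
have t0 := trajectory0 (X eta0 q0).
have : charge a phi (topple x0 s' xi) = charge a phi x0.
  apply: (ae_first_step (@kern_ge0 R V N)
    (@trajectory_measurable R V N eta0 q0 (X eta0 q0))
    (@trajectory_markov R V N eta0 q0 (X eta0 q0))
    (Q := fun y => charge a phi y = charge a phi x0) t0 _ k0).
  apply: filterS2 t0 (cons eta0 q0) => w w0 /(_ 1%N) w1.
  by rewrite -[x0]w0; exact: w1.
rewrite charge_topple qs; set S := \sum_w _ => h.
by apply: (addrI (charge a phi x0)); rewrite addr0 -[RHS]h; ring.
Qed.

(** Averaging the identity over a stationary step of the environment of [v]
    cancels [phi]. *)
Lemma null_increments_mean : null_increments -> forall v,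
  \sum_w entry (topple_mx N) v w * a w = 0.
Proof.
move=> null v; have [pi0 pi1 piP] := env_stat_stationary N v.
have mean0 (s s' : env_state N v) : 0 < env_trans N v s s' ->
    phi s' - phi s + \sum_w a w * mean_topple s' w = 0.
  move=> Ps; suff : (phi s' - phi s + \sum_w a w * mean_topple s' w)%:E = 0%:E.
    by case.
  rewrite -(integrable_affine s' a _).2 -(integral_law_cst (topple_law N v s') 0).
  apply: ae_eq_integral.
  - exact: measurable_config.
  - exact: measurable_fun_config.
  - exact: measurable_fun_config.
  - by apply: law_ae => xi xipos _; rewrite null.
have zero : \sum_s env_stat N v s * \sum_s' env_trans N v s s' *
    (phi s' - phi s + \sum_w a w * mean_topple s' w) = 0.
  rewrite big1// => s _; rewrite big1 ?mulr0// => s' _.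
  have := env_trans_ge0 s s'; rewrite le_eqVlt => /orP[/eqP <-|/mean0 ->].
    by rewrite mul0r.
  by rewrite mulr0.
have avg (f : env_state N v -> R) :
    \sum_s env_stat N v s * \sum_s' env_trans N v s s' * f s' =
    \sum_s env_stat N v s * f s.
  under eq_bigr do rewrite mulr_sumr.
  rewrite exchange_big/=; apply: eq_bigr => s' _.
  by rewrite -piP mulr_suml; apply: eq_bigr => s _; rewrite mulrA.
have split_step s : \sum_s' env_trans N v s s' *
    (phi s' - phi s + \sum_w a w * mean_topple s' w) =
    \sum_s' env_trans N v s s' * (\sum_w a w * mean_topple s' w) +
    \sum_s' env_trans N v s s' * phi s' - phi s.
  rewrite -[X in _ - X]mul1r -(sum_env_trans s) mulr_suml -big_split -sumrB.
  by apply: eq_bigr => s' _ /=; ring.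
transitivity (\sum_s env_stat N v s * \sum_w a w * mean_topple s w).
  under eq_bigr do rewrite topple_mxE mulr_suml.
  rewrite exchange_big/=; apply: eq_bigr => s _.
  rewrite mulr_sumr; apply: eq_bigr => w _.
  by rewrite -mulrA [a w * _]mulrC.
move: zero; under eq_bigr do rewrite split_step mulrBr mulrDr.
by rewrite sumrB big_split/= !avg addrK.
Qed.

(** The charge is preserved, and it is bounded on stable states: enough particles
    at the start exclude stabilization. *)
Lemma null_increments_unstable : (0 < #|V|)%N ->
  (forall v, 0 < a v) -> null_increments ->
  exists eta0 q0, ~ stabilizes_as (X eta0 q0).
Proof.
move=> V_gt0 a0 null; have [q] := env_inhabited.
pose B : R := \sum_v \sum_(s : env_state N v) `|phi s|.
pose T : R := \sum_v a v * (threshold N v)%:R.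
have phiB (q' : env N) : `|\sum_v phi (q' v)| <= B.
  apply: le_trans (ler_norm_sum _ _ _) _; apply: ler_sum => v _.
  by rewrite (bigD1 (q' v))//= lerDl sumr_ge0.
have A0 : 0 < \sum_v a v.
  have /card_gt0P[v0 _] := V_gt0; rewrite (bigD1 v0)//=.
  by apply: ltr_pwDl => //; apply: sumr_ge0 => w _; exact: ltW.
pose K := Num.bound (`|T + B + B| / \sum_v a v).
have KA : T + B + B < (\sum_v a v) * K%:R.
  apply: le_lt_trans (ler_norm _) _; rewrite mulrC -ltr_pdivrMr//.
  by apply: archi_boundP; rewrite divr_ge0// ltW.
exists (fun=> K), q => st.
have t0 := trajectory0 (X (fun=> K) q).
have an0 : exists v, a v != 0.
  by have /card_gt0P[v0 _] := V_gt0; exists v0; rewrite gt_eqF.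
have [_ cons] := null_increments_conserved an0 null.
have : {ae law (X (fun=> K) q), forall w, False}.
  apply: filterS3 st t0 (cons (fun=> K) q) => w [n nst] w0 /(_ n) cn.
  have : charge a phi (trajectory n w) = charge a phi (initial_state (fun=> K) q).
    by rewrite -w0.
  rewrite /charge /charge_at !big_split/= => cE.
  have le1 : \sum_v a v * (eta_ (X (fun=> K) q) n w v)%:~R <= T.
    apply: ler_sum => v _; apply: ler_wpM2l; first exact: ltW.
    by have /forallP/(_ v) := nst; rewrite -(ler_int R).
  have eq2 : \sum_v a v * (config_of_nat (fun=> K) v)%:~R = (\sum_v a v) * K%:R.
    by rewrite mulr_suml; apply: eq_bigr => v _; rewrite ffunE.
  rewrite eq2 in cE.
  have := phiB (q_ (X (fun=> K) q) n w); have := phiB q.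
  rewrite !ler_norml => /andP[q1 q2] /andP[q3 q4].
  suff : (\sum_v a v) * K%:R <= T + B + B by rewrite leNgt KA.
  move/eqP: cE; rewrite -subr_eq => /eqP <-.
  by apply: lerD; [exact: lerD|rewrite lerNl].
move=> [A [mA A0' sub]].
have AT : A = setT by apply/seteqP; split=> // w _; exact: sub.
rewrite AT in A0'.
have /eqP := etrans (esym (probability_setT (law (X (fun=> K) q)))) A0'.
by rewrite onee_eq0.
Qed.
End ConservedQuantities.

Lemma null_incrementsZ (R : realType) (V : finType) (N : network R V)
    (a : V -> R) (phi : forall v, env_state N v -> R) c :
  null_increments a phi ->
  null_increments (fun v => c * a v) (fun v s => c * phi v s).
Proof.
move=> null v s s' xi Ps xipos; have := null v s s' xi Ps xipos.
under [in X in _ -> X]eq_bigr do rewrite -mulrA.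
by rewrite -mulr_sumr -mulrBr -mulrDr => ->; rewrite mulr0.
Qed.

(** * The subcritical and critical cases *)

Section Regimes.
Variables (R : realType) (V : finType) (N : network R V).
Variable X : forall (eta0 : V -> nat) (q0 : env N), realization eta0 q0.
Hypothesis V_gt0 : (0 < #|V|)%N.
Hypothesis xi_offdiag_ge0 : forall (v : V) (s : env_state N v) (w : V), w != v ->
  {ae topple_law N v s, forall xi : config V, 0 <= xi w}.
Hypothesis xi_diag_ge : forall (v : V) (s : env_state N v),
  {ae topple_law N v s, forall xi : config V, - xi v <= (threshold N v)%:Z}.
Hypothesis M_irr : exists2 k : nat, (1 <= k)%N & forall v w : V, v != w ->
  0 < entry ((topple_mx N - diag_part (topple_mx N)) ^+ k) v w.

Let rho := rho_of (topple_mx N).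

Lemma subcritical_stabilizes eta0 q0 : rho < 0 -> stabilizes_as (X eta0 q0).
Proof.
move=> rho0; have [a [a0 Ma _]] := exists_Perron_vector V_gt0
  (topple_mx_offdiag_ge0 xi_offdiag_ge0) M_irr.
have [phi phiP] := exists_corrector Ma.
apply: (no_trap_stabilizes xi_offdiag_ge0 xi_diag_ge a0 phiP) => [|D tD].
  exact: ltW.
have [rho00 _] :=
  trap_constant_charge xi_offdiag_ge0 xi_diag_ge a0 phiP (ltW rho0) tD.
by move: rho0; rewrite /rho rho00 ltxx.
Qed.

Lemma critical_dichotomy : rho = 0 ->
  (exists a phi, conserved_quantity X a phi) \/
  (forall eta0 q0, stabilizes_as (X eta0 q0)).
Proof.
move=> rho0; have [a [a0 Ma _]] := exists_Perron_vector V_gt0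
  (topple_mx_offdiag_ge0 xi_offdiag_ge0) M_irr.
have [phi phiP] := exists_corrector Ma.
have rho_le0 : rho <= 0 by rewrite rho0.
have [[D tD]|notrap] := pselect (exists D, @net_trap R V N D); [left|right].
  have [_ [m tDm]] :=
    trap_constant_charge xi_offdiag_ge0 xi_diag_ge a0 phiP rho_le0 tD.
  exists a, phi; apply: null_increments_conserved.
    by have /card_gt0P[v0 _] := V_gt0; exists v0; rewrite gt_eqF.
  exact: (trap_increments xi_offdiag_ge0 M_irr tDm).
move=> eta0 q0; apply: (no_trap_stabilizes xi_offdiag_ge0 xi_diag_ge a0 phiP) => //.
by move=> D tD; apply: notrap; exists D.
Qed.

(** By simplicity of the Perron eigenvalue the weights of any conserved quantity
    are proportional to the positive eigenvector, so that a configuration of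
    large charge can never become stable. *)
Lemma critical_exclusive : rho = 0 ->
  ~ ((exists a phi, conserved_quantity X a phi) /\
     (forall eta0 q0, stabilizes_as (X eta0 q0))).
Proof.
move=> rho0 [[b [psi cons]] stab].
have [a [a0 _ simple]] := exists_Perron_vector V_gt0
  (topple_mx_offdiag_ge0 xi_offdiag_ge0) M_irr.
have null := conserved_null_increments cons.
have [[v bv] _] := cons.
have [|c bE] := simple b.
  by move=> w; rewrite -/rho rho0 mul0r; exact: null_increments_mean null w.
have c0 : c != 0 by apply: contraNneq bv => c0; rewrite bE c0 mul0r.
(* Multiplying by [c] makes all the weights positive. *)
have [|eta0 [q0]] := null_increments_unstable X V_gt0 _ (null_incrementsZ c null).
  by move=> w; rewrite bE mulrA mulr_gt0// -expr2 exprn_even_gt0.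
by apply; exact: stab.
Qed.
End Regimes.

(** * Escape in the supercritical case *)

Section InverseExpectation.
Variables (R : realType) (V : finType) (nu : probability (config V) R).
Variable Y : config V -> R.
Hypothesis Y_ge0 : forall z, 0 <= Y z.
Hypothesis Y_int : nu.-integrable setT (EFin \o Y).

Let rem u z := Y z ^+ 2 / (u + Y z).

Let rem_ge0 u z : 0 < u -> 0 <= rem u z.
Proof. by move=> u0; rewrite divr_ge0 ?sqr_ge0// addr_ge0// ltW. Qed.

Let rem_leY u z : 0 < u -> rem u z <= Y z.
Proof.
move=> u0; rewrite ler_pdivrMr ?ltr_pwDl// expr2 ler_wpM2l// lerDr.
exact: ltW.
Qed.

Let rem_le u u' z : 0 < u -> u <= u' -> rem u' z <= rem u z.
Proof.
move=> u0 uu'; rewrite ler_wpM2l ?sqr_ge0// lef_pV2 ?posrE ?ltr_pwDl//.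
  by rewrite lerD2r.
exact: lt_le_trans uu'.
Qed.

Let rem_int u : 0 < u -> nu.-integrable setT (EFin \o rem u).
Proof.
move=> u0; apply: le_integrable Y_int => //.
move=> z _ /=; rewrite lee_fin !ger0_norm//; first exact: rem_leY.
exact: rem_ge0.
Qed.

Lemma rem_small delta : 0 < delta -> exists n : nat, forall u, n.+1%:R <= u ->
  (\int[nu]_z (rem u z)%:E <= delta%:E)%E.
Proof.
move=> delta0.
have : (fun n : nat => \int[nu]_z (rem n.+1%:R z)%:E)%E @ \oo -->
    (\int[nu]_z cst 0 z)%E.
  apply: (@dominated_cvg _ _ _ nu setT measurableT _ _ (EFin \o Y)).
  - by move=> n; exact: measurable_fun_config.
  - move=> z _; apply: cvg_EFin; first exact: nearW.
    apply: (@squeeze_cvgr _ _ _ _ (fun=> 0) (fun n => Y z ^+ 2 * harmonic n)).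
    + apply: nearW => n; rewrite /= rem_ge0//= ler_wpM2l ?sqr_ge0//.
      by rewrite lef_pV2 ?posrE ?ltr_pwDl// lerDl.
    + exact: cvg_cst.
    + rewrite -(mulr0 (Y z ^+ 2)); apply: cvgMr; exact: cvg_harmonic.
  - by [].
  - exact: Y_int.
  - by move=> n z _ /=; rewrite lee_fin ger0_norm ?rem_ge0// rem_leY.
rewrite integral0 => /fine_cvgP[_ /cvgrPdist_lt/(_ _ delta0)[n _ /(_ n (leqnn n))]].
rewrite /= sub0r normrN => rn; exists n => u nu_le.
have u0 : 0 < u by apply: lt_le_trans nu_le.
apply: (@le_trans _ _ (\int[nu]_z (rem n.+1%:R z)%:E)%E).
  apply: ge0_le_integral => //; try exact: measurable_fun_config.
  - by move=> z _; rewrite lee_fin rem_ge0.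
  - by move=> z _; rewrite lee_fin rem_le.
have fin := integrable_fin_num measurableT (rem_int (ltr0Sn R n)).
rewrite -[leLHS](fineK fin) lee_fin; apply: le_trans (ltW rn).
exact: ler_norm.
Qed.

(** Expanding [1 / (u + Y)] to second order in [Y / u]: the remainder tends to
    zero by dominated convergence, [Y] itself being a dominating function. *)
Lemma inverse_expectation delta : 0 < delta -> exists n : nat, forall u,
  n.+1%:R <= u -> (\int[nu]_z ((u + Y z)^-1)%:E <=
    (u^-1 - (fine (\int[nu]_z (Y z)%:E) - delta) / u ^+ 2)%:E)%E.
Proof.
move=> delta0; have [n small] := rem_small delta0; exists n => u nu_le.
have u0 : 0 < u by apply: lt_le_trans nu_le.
have fE : (fun z : config V => ((u + Y z)^-1)%:E) = ((EFin \o cst (u^-1)%R) \+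
    ((fun z => (- u ^- 2)%:E * (EFin \o Y) z) \+
     (fun z => (u ^- 2)%:E * (EFin \o rem u) z)))%E.
  apply/funext => z /=; rewrite -!EFinM -!EFinD; congr EFin; rewrite /rem.
  have uY : u + Y z != 0 by rewrite gt_eqF// ltr_pwDl.
  by field; rewrite uY gt_eqF.
have i1 := finite_measure_integrable_cst nu u^-1 measurableT.
have i2 := integrableZl measurableT (- u ^- 2) Y_int.
have i3 := integrableZl measurableT (u ^- 2) (rem_int u0).
rewrite fE integralD//; last exact: integrableD.
rewrite integralD// !integralZl//; last exact: rem_int.
rewrite integral_law_cst.
have finY := integrable_fin_num measurableT Y_int.
rewrite -[X in (_ + (_ * X + _))%E](fineK finY) -EFinM.
apply: (@le_trans _ _ ((u^-1)%:E + ((- u ^- 2 * fine (\int[nu]_z (Y z)%:E))%:E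
   + (u ^- 2)%:E * delta%:E))%E).
  by rewrite leeD2l// leeD2l// lee_wpmul2l ?lee_fin ?invr_ge0 ?sqr_ge0 ?small.
rewrite -EFinM -!EFinD lee_fin le_eqVlt; apply/orP; left; apply/eqP.
by field; rewrite gt_eqF.
Qed.
End InverseExpectation.

Section Escape.
Variables (R : realType) (V : finType) (N : network R V).
Local Notation state := (config V * env N)%type.
Hypothesis xi_offdiag_ge0 : forall (v : V) (s : env_state N v) (w : V), w != v ->
  {ae topple_law N v s, forall xi : config V, 0 <= xi w}.
Hypothesis xi_diag_ge : forall (v : V) (s : env_state N v),
  {ae topple_law N v s, forall xi : config V, - xi v <= (threshold N v)%:Z}.
Variables (a : V -> R) (phi : forall v, env_state N v -> R) (rho c : R).
Hypothesis a_gt0 : forall v, 0 < a v.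
Hypothesis phiP : corrector a phi rho.
Hypothesis rho_gt0 : 0 < rho.
Hypothesis charge_lb : forall x : state, nonneg x ->
  \sum_v a v * (x.1 v)%:~R <= charge a phi x + c.

Let Z (x : state) := potential a phi c x + 1.

Let Z_gt0 x : 0 < Z x.
Proof. by rewrite ltr_wpDl// potential_ge0. Qed.

Definition increment v (s s' : env_state N v) (xi : config V) : R :=
  phi s' - phi s + \sum_w a w * (xi w)%:~R.

Let Z_topple x v (s : env_state N v) xi : nonneg x ->
  (threshold N v)%:Z < x.1 v -> (0 < topple_law N v s [set xi])%E ->
  Z (topple x s xi) = Z x + increment (x.2 v) s xi.
Proof.
move=> x0 tv xipos; rewrite /Z !(potentialE a_gt0 charge_lb)//; last first.
  exact: (topple_nonneg xi_offdiag_ge0 xi_diag_ge).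
by rewrite charge_topple /increment; ring.
Qed.

(** A toppling removes at most the threshold from the toppled vertex, so the
    increments are bounded below. *)
Lemma increment_lb : exists b, 0 <= b /\ forall v (s s' : env_state N v) xi,
  (0 < topple_law N v s' [set xi])%E -> 0 <= b + increment s s' xi.
Proof.
pose B v := \sum_(s : env_state N v) `|phi s|.
pose b := \sum_v (a v * (threshold N v)%:R + (B v + B v)).
have B0 v : 0 <= B v by exact: sumr_ge0.
have t0 v : 0 <= a v * (threshold N v)%:R by rewrite mulr_ge0// ltW.
exists b; split.
  by apply: sumr_ge0 => v _; rewrite !addr_ge0.
move=> v s s' xi xipos.
have phiB (s1 : env_state N v) : `|phi s1| <= B v.
  by rewrite /B (bigD1 s1)//= lerDl sumr_ge0.
have bv : a v * (threshold N v)%:R + (B v + B v) <= b.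
  by rewrite /b (bigD1 v)//= lerDl sumr_ge0// => w _; rewrite !addr_ge0.
have sumxi : - (a v * (threshold N v)%:R) <= \sum_w a w * (xi w)%:~R.
  rewrite (bigD1 v)//=; apply: ler_wpDr.
    apply: sumr_ge0 => w wv; apply: mulr_ge0; first exact: ltW.
    by rewrite ler0z; exact: (law_pos_ae (xi_offdiag_ge0 s' wv)).
  rewrite -mulrN ler_pM2l// lerNl -rmorphN/=.
  rewrite -[leRHS]/((threshold N v)%:Z%:~R) ler_int.
  exact: (law_pos_ae (xi_diag_ge s')).
have p1 : - B v <= phi s' by have := phiB s'; rewrite ler_norml => /andP[].
have p2 : - B v <= - phi s by have := phiB s; rewrite ler_norml lerN2 => /andP[].
rewrite -lerBlDl sub0r; apply: le_trans (lerD (lerD p1 p2) sumxi).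
by rewrite -!opprD lerN2 addrC.
Qed.

Lemma transfer_avg_le (f : state -> R) x (h : forall v, env_state N v -> R) :
  (forall y, 0 <= f y) -> ~~ stable N x.1 ->
  (forall v (s : env_state N v), (threshold N v)%:Z < x.1 v ->
    (\int[topple_law N v s]_xi (f (topple x s xi))%:E <= (h v s)%:E)%E) ->
  (transfer (@kern R V N) f x <= (\sum_v choice_prob N x.1 v *
    \sum_s env_trans N v (x.2 v) s * h v s)%:E)%E.
Proof.
move=> f0 xs hE; rewrite transferE// -sumEFin; apply: lee_sum => v _.
rewrite mulr_sumr -sumEFin; apply: lee_sum => s _.
have [tv|] := boolP ((threshold N v)%:Z < x.1 v).
  rewrite mulrA [leRHS]EFinM; apply: lee_wpmul2l; last exact: hE.
  by rewrite lee_fin mulr_ge0 ?choice_prob_ge0 ?env_trans_ge0.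
rewrite -(@choice_prob_gt0 R) lt_neqAle choice_prob_ge0 andbT negbK => /eqP <-.
by rewrite !mul0r mul0e.
Qed.

Lemma increment_inverse b (delta : R) : 0 < delta ->
  (forall v (s s' : env_state N v) xi,
    (0 < topple_law N v s' [set xi])%E -> 0 <= b + increment s s' xi) ->
  exists n : nat, forall v (s s' : env_state N v) u, n.+1%:R <= u ->
    (\int[topple_law N v s']_xi
       ((u + Num.max 0 (b + increment s s' xi))^-1)%:E <=
     (u^-1 - (b + phi s' - phi s + \sum_w a w * mean_topple s' w - delta)
         / u ^+ 2)%:E)%E.
Proof.
move=> delta0 lb.
have one v (s s' : env_state N v) : exists n : nat, forall u, n.+1%:R <= u ->
    (\int[topple_law N v s']_xi
       ((u + Num.max 0 (b + increment s s' xi))^-1)%:E <=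
     (u^-1 - (b + phi s' - phi s + \sum_w a w * mean_topple s' w - delta)
         / u ^+ 2)%:E)%E.
  have [aint aval] := integrable_affine s' a (b + phi s' - phi s).
  pose Y xi := Num.max 0 (b + increment s s' xi).
  have affE (xi : config V) : b + phi s' - phi s + \sum_w a w * (xi w)%:~R =
      b + increment s s' xi by rewrite /increment; ring.
  have Yae : ae_eq (topple_law N v s') setT
      (fun xi => (b + phi s' - phi s + \sum_w a w * (xi w)%:~R)%:E) (EFin \o Y).
    apply: law_ae => xi xipos _; rewrite /Y /=.
    by rewrite (max_idPr (lb _ s s' xi xipos)) affE.
  have Yint : (topple_law N v s').-integrable setT (EFin \o Y).
    apply: le_integrable aint => // xi _ /=; rewrite lee_fin ger0_norm.
      by rewrite affE ge_max normr_ge0 ler_norm.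
    by rewrite le_max lexx.
  have Y0 xi : 0 <= Y xi by rewrite le_max lexx.
  have [n nP] := inverse_expectation Y0 Yint delta0.
  exists n => u /nP; rewrite -(_ : \int[topple_law N v s']_xi
     (b + phi s' - phi s + \sum_w a w * (xi w)%:~R)%:E =
     \int[topple_law N v s']_xi (Y xi)%:E)%E.
    by rewrite aval.
  by apply: ae_eq_integral => //; exact: measurable_fun_config.
have [F FP] : exists F : forall v, env_state N v -> env_state N v -> nat,
    forall v (s s' : env_state N v) u, (F v s s').+1%:R <= u ->
    (\int[topple_law N v s']_xi
       ((u + Num.max 0 (b + increment s s' xi))^-1)%:E <=
     (u^-1 - (b + phi s' - phi s + \sum_w a w * mean_topple s' w - delta)
         / u ^+ 2)%:E)%E.
  exists (fun v s s' => sval (cid (one v s s'))) => v s s'.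
  exact: svalP (cid (one v s s')).
exists (\max_v \max_s \max_s' F v s s')%N => v s s' u nu_le.
apply: FP; apply: le_trans nu_le; rewrite ler_nat ltnS.
apply: leq_trans (leq_bigmax v); apply: leq_trans (leq_bigmax s).
exact: leq_bigmax.
Qed.

Let Z_stable : exists T, 0 <= T /\ forall x, nonneg x -> stable N x.1 -> Z x <= T.
Proof.
pose B v := \sum_(s : env_state N v) `|phi s|.
exists (`|c| + 1 + \sum_v (a v * (threshold N v)%:R + B v)); split.
  rewrite !addr_ge0//; apply: sumr_ge0 => v _.
  by rewrite addr_ge0 ?sumr_ge0// mulr_ge0// ltW.
move=> x x0 xs; rewrite /Z (potentialE a_gt0 charge_lb)// -addrA addrC.
apply: lerD; first by rewrite lerD2r ler_norm.
apply: ler_sum => v _; apply: lerD.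
  rewrite ler_pM2l// -[leRHS]/((threshold N v)%:Z%:~R) ler_int.
  by have /forallP := xs.
apply: le_trans (ler_norm _) _.
by rewrite /B (bigD1 (x.2 v))//= lerDl sumr_ge0.
Qed.

(** Far from the stable states the drift dominates the second-order remainder,
    so a multiple of the inverse of the potential is superharmonic there. *)
Lemma exists_escape_function : (0 < #|V|)%N -> exists W : state -> R,
  [/\ forall x, 0 <= W x,
      forall x, nonneg x -> stable N x.1 -> W x = 1,
      forall x, nonneg x -> (transfer (@kern R V N) W x <= (W x)%:E)%E &
      forall q0, exists eta0, W (initial_state eta0 q0) <= 2^-1].
Proof.
move=> V_gt0.
have [delta delta0 delta_le] := @exists_ratio_lb R V (fun=> 1) (fun v => rho * a v)
  (fun=> ltr01) (fun v => mulr_gt0 rho_gt0 (a_gt0 v)).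
have [b [b0 lb]] := increment_lb; have [n nP] := increment_inverse delta0 lb.
have [T [T0 TP]] := Z_stable.
(* Above level [z0] a state is unstable, and [u] below is at least [n.+1]. *)
pose z0 := b + n.+1%:R + T.
have z0_gt0 : 0 < z0 by rewrite /z0 ltr_pwDl// ltr_wpDl.
have W1 x : Z x <= z0 -> Num.min 1 (z0 / Z x) = 1.
  by move=> zx; apply/min_idPl; rewrite ler_pdivlMr// mul1r.
have zZ0 x : 0 <= z0 / Z x by rewrite divr_ge0// ltW.
have W0 x : 0 <= Num.min 1 (z0 / Z x) by rewrite le_min ler01 zZ0.
have stable_le x : nonneg x -> stable N x.1 -> Z x <= z0.
  move=> x0 xs; apply: le_trans (TP x x0 xs) _.
  by rewrite /z0 lerDr addr_ge0.
exists (fun x => Num.min 1 (z0 / Z x)); split.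
- exact: W0.
- by move=> x x0 xs; rewrite W1// stable_le.
- move=> x x0; have [zx|zx] := leP (Z x) z0.
    rewrite W1// -(transfer1 x); apply: le_transfer => [y z|y _].
      exact: kern_ge0.
    by rewrite ge_min lexx.
  have xs : ~~ stable N x.1.
    by apply/negP => /(stable_le x x0); rewrite leNgt zx.
  apply: (@le_trans _ _ (z0 / Z x)%:E); last first.
    rewrite lee_fin le_min lexx andbT ler_pdivrMr// mul1r; exact: ltW.
  apply: (@le_trans _ _ (transfer (@kern R V N) (fun y => z0 / Z y) x)).
    apply: le_transfer => [y z|y _]; first exact: kern_ge0.
    by rewrite ge_min lexx orbT.
  (* Shifting by [b] makes the increments nonnegative. *)
  pose u := Z x - b.
  have nu_le : n.+1%:R <= u.
    by rewrite /u lerBrDl; apply: le_trans (ltW zx); rewrite /z0 lerDl.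
  have u0 : 0 < u by apply: lt_le_trans nu_le.
  pose h v (s : env_state N v) := z0 * (u^-1 -
    (b + phi s - phi (x.2 v) + \sum_w a w * mean_topple s w - delta) / u ^+ 2).
  apply: (le_trans (transfer_avg_le (h := h) zZ0 xs _)).
    move=> v s tv.
    rewrite (ae_eq_integral (fun xi => z0%:E *
       ((u + Num.max 0 (b + increment (x.2 v) s xi))^-1)%:E)%E).
    + rewrite ge0_integralZl//.
      * by rewrite EFinM; apply: lee_wpmul2l; [rewrite lee_fin ltW|exact: nP].
      * move=> xi _; rewrite lee_fin invr_ge0; apply: addr_ge0; first exact: ltW.
        by rewrite le_max lexx.
      * exact: ltW.
    + exact: measurable_config.
    + exact: measurable_fun_config.
    + exact: measurable_fun_config.
    + apply: law_ae => xi xipos _; rewrite -EFinM; congr EFin.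
      rewrite Z_topple// (max_idPr (lb _ (x.2 v) s xi xipos)) /u.
      by congr (_ * _^-1); ring.
  have avg v : \sum_s env_trans N v (x.2 v) s * h v s =
      z0 * (u^-1 - (b - delta + rho * a v) / u ^+ 2).
    rewrite -(phiP (x.2 v)).
    transitivity (\sum_s (env_trans N v (x.2 v) s *
        (z0 * (u^-1 - (b - phi (x.2 v) - delta) / u ^+ 2)) -
      (z0 / u ^+ 2) * (env_trans N v (x.2 v) s *
        (\sum_w a w * mean_topple s w + phi s)))).
      by apply: eq_bigr => s _; rewrite /h; ring.
    by rewrite sumrB -mulr_suml sum_env_trans -mulr_sumr; ring.
  rewrite lee_fin; under eq_bigr do rewrite avg.
  apply: (@le_trans _ _ (\sum_v choice_prob N x.1 v * (z0 * (u^-1 - b / u ^+ 2)))).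
    apply: ler_sum => v _; apply: ler_wpM2l; first exact: choice_prob_ge0.
    rewrite ler_pM2l// lerD2l lerN2 ler_pM2r ?invr_gt0 ?exprn_gt0//.
    by rewrite -addrA lerDl addrC subr_ge0; have := delta_le v; rewrite mulr1.
  rewrite -mulr_suml sum_choice_prob// mul1r ler_pM2l//.
  have Zu : Z x = u + b by rewrite /u subrK.
  rewrite Zu -subr_ge0.
  have ub0 : 0 < u + b by rewrite -Zu.
  rewrite (_ : _ - _ = b ^+ 2 / (u ^+ 2 * (u + b))).
    by rewrite divr_ge0 ?sqr_ge0// mulr_ge0 ?sqr_ge0// ltW.
  by field; rewrite !gt_eqF.
- move=> q0; have A0 : 0 < \sum_v a v.
    have /card_gt0P[v0 _] := V_gt0; rewrite (bigD1 v0)//=.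
    by apply: ltr_pwDl => //; apply: sumr_ge0 => w _; exact: ltW.
  (* So many particles make the potential at least [2 * z0]. *)
  pose K := Num.bound (2 * z0 / \sum_v a v).
  exists (fun=> K); set x := initial_state _ _.
  rewrite ge_min; apply/orP; right; rewrite ler_pdivrMr// mulrC ler_pdivlMr//.
  rewrite mulrC; apply: (@le_trans _ _ ((\sum_v a v) * K%:R)).
    rewrite [leRHS]mulrC -ler_pdivrMr//; apply/ltW/archi_boundP.
    by rewrite divr_ge0 ?mulr_ge0// ltW.
  have x0 : nonneg x by exact: initial_nonneg.
  rewrite /Z (potentialE a_gt0 charge_lb x0) ler_wpDr//.
  apply: le_trans (charge_lb x0); rewrite mulr_suml.
  by apply: ler_sum => v _; rewrite ffunE.
Qed.
End Escape.
Section Supercritical.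
Variables (R : realType) (V : finType) (N : network R V).
Local Notation state := (config V * env N)%type.
Hypothesis V_gt0 : (0 < #|V|)%N.
Hypothesis xi_offdiag_ge0 : forall (v : V) (s : env_state N v) (w : V), w != v ->
  {ae topple_law N v s, forall xi : config V, 0 <= xi w}.
Hypothesis xi_diag_ge : forall (v : V) (s : env_state N v),
  {ae topple_law N v s, forall xi : config V, - xi v <= (threshold N v)%:Z}.
Hypothesis M_irr : exists2 k : nat, (1 <= k)%N & forall v w : V, v != w ->
  0 < entry ((topple_mx N - diag_part (topple_mx N)) ^+ k) v w.

(** Stable configurations are absorbing, so up to a null set the events of being
    stable at time [n] increase to stabilization. *)
Lemma stabilization_le eta0 (q0 : env N) (X : realization eta0 q0) (e : \bar R) :
  (forall n, law X [set w | stable N (eta_ X n w)] <= e)%E ->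
  (law X (stabilization_event X) <= e)%E.
Proof.
move=> Xe; pose B n := [set w | stable N (eta_ X n w)].
have mB n : measurable (B n).
  exact: (measurable_event (@trajectory_measurable R V N eta0 q0 X) n
    (fun x : state => stable N x.1)).
have absorbing x y : 0 < @kern R V N x y -> stable N x.1 -> stable N y.1.
  move=> kxy xs; move: kxy; rewrite kern_stable//.
  by case: eqP => [->//|_]; rewrite ltxx.
have [A [mA A0 sub]] := ae_transition (@kern_ge0 R V N)
  (@trajectory_measurable R V N eta0 q0 X) (@trajectory_markov R V N eta0 q0 X)
  absorbing.
pose D n := B n `|` A.
have mD n : measurable (D n) by exact: measurableU.
have Dmono : nondecreasing_seq D.
  apply/nondecreasing_seqP => n; rewrite subsetEset => w [Bw|]; last by right.
  have [Aw|nAw] := pselect (A w); first by right.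
  left; have step : forall n, stable N (trajectory n w).1 ->
      stable N (trajectory n.+1 w).1.
    by apply: contrapT => ns; apply: nAw; exact: sub.
  exact: step.
have mUD : measurable (\bigcup_n D n) by exact: bigcupT_measurable.
have De n : (law X (D n) <= e)%E.
  apply: le_trans (Xe n); apply: (le_trans (measureU2 (law X) (mB n) mA)).
  by rewrite [X in (_ + X)%E]A0 adde0.
apply: (@le_trans _ _ (law X (\bigcup_n D n))).
  apply: le_measure; rewrite ?inE//.
    rewrite (_ : stabilization_event X = \bigcup_n B n).
      exact: bigcupT_measurable.
    by apply/seteqP; split=> w [n]; exists n.
  by move=> w [n Bn]; exists n => //; left.
have lim := nondecreasing_cvg_mu mD mUD Dmono (mu := law X).
rewrite -(cvg_lim (@ereal_hausdorff R) lim); apply: lime_le.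
  by apply/cvg_ex; eexists; exact: lim.
exact: nearW.
Qed.

(** The escape function dominates the indicator of stable states and is
    superharmonic, so at every time stability has probability at most [1 / 2]. *)
Lemma supercritical_escapes
  (X : forall (eta0 : V -> nat) (q0 : env N), realization eta0 q0) :
  0 < rho_of (topple_mx N) -> forall q0, exists eta0,
  (0 < law (X eta0 q0) (~` stabilization_event (X eta0 q0)))%E.
Proof.
move=> rho0 q0; have [a [a0 Ma _]] := exists_Perron_vector V_gt0
  (topple_mx_offdiag_ge0 xi_offdiag_ge0) M_irr.
have [phi phiP] := exists_corrector Ma.
have [c c_lb] := exists_lb_charge phi a0.
have [W [W0 W1 Wsup Wsmall]] := exists_escape_function
  xi_offdiag_ge0 xi_diag_ge a0 phiP rho0 c_lb V_gt0.
have [eta0 We] := Wsmall q0; exists eta0; set st := X eta0 q0.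
have mtraj := @trajectory_measurable R V N eta0 q0 st.
have stable_le n : (law st [set w | stable N (eta_ st n w)] <= (2^-1)%:E)%E.
  apply: (@le_trans _ _ (W (initial_state eta0 q0))%:E); last by rewrite lee_fin.
  rewrite (measure_expect (law st) mtraj n (fun x : state => stable N x.1)).
  apply: (expect_le (@kern_ge0 R V N) mtraj (@trajectory_markov R V N eta0 q0 st)
    (trajectory0 st) (initial_nonneg eta0 q0)
    (nonneg_closed xi_offdiag_ge0 xi_diag_ge)
    (f := fun x : state => (stable N x.1)%:R) (u := fun _ => W)) => //.
  by move=> x x0; have [/(W1 _ x0) ->|_] := boolP (stable N x.1).
have mE : measurable (stabilization_event st).
  rewrite (_ : stabilization_event st =
      \bigcup_n [set w | stable N (trajectory n w).1]).
    apply: bigcupT_measurable => n.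
    exact: (measurable_event mtraj n (fun x : state => stable N x.1)).
  by apply/seteqP; split=> w [n]; exists n.
have le2 := stabilization_le stable_le.
have -> : law st (~` stabilization_event st) =
    (1 - law st (stabilization_event st))%E.
  exact: probability_setC.
rewrite sube_gt0; apply: le_lt_trans le2 _.
by rewrite lte_fin invf_lt1 ?ltr1n.
Qed.
End Supercritical.

Theorem theorem1p1 (R : realType) (V : finType) (E : rel V)
    (connE : connected_digraph E) (N : network R V)
    (X : forall (eta0 : V -> nat) (q0 : env N), realization eta0 q0)
    (xi_offdiag_ge0 : forall (v : V) (s : env_state N v) (w : V), w != v ->
       {ae topple_law N v s, forall xi : config V, 0 <= xi w})
    (xi_diag_ge : forall (v : V) (s : env_state N v),
       {ae topple_law N v s,
         forall xi : config V, - xi v <= (threshold N v)%:Z})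
    (M_irred : exists2 k : nat, (1 <= k)%N &
       forall v w : V, v != w ->
         0 < entry ((topple_mx N - diag_part (topple_mx N)) ^+ k) v w) :
  let rho := rho_of (topple_mx N) in
  [/\ rho < 0 ->
        forall (eta0 : V -> nat) (q0 : env N), stabilizes_as (X eta0 q0),
      rho = 0 ->
        let has_conserved := exists a phi, conserved_quantity X a phi in
        let stabilizes :=
          forall (eta0 : V -> nat) (q0 : env N), stabilizes_as (X eta0 q0) in
        (has_conserved \/ stabilizes) /\ ~ (has_conserved /\ stabilizes)
    & 0 < rho ->
        forall q0 : env N, exists eta0 : V -> nat,
          (0 < law (X eta0 q0) (~` stabilization_event (X eta0 q0)))%E].
Proof.
have V_gt0 := connE.1; move=> rho; split.
- by move=> rho0 eta0 q0; exact: subcritical_stabilizes.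
- move=> rho0; split; first exact: critical_dichotomy.
  exact: critical_exclusive.
- by move=> rho0; exact: supercritical_escapes.
Qed.
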